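(* Let $G$ be a graph with $n$ vertices that is not 2-paintable. Then: (a) if $G=C_r\cdot P_k\cdot C_s$ with $r,s\ge 4$ (and $k\ge1$), then $M(G)\ge n+2$; (b) if $G=\theta_{p,q,r}$ with $p\ge 3$ and $q+r\ge 4$, then $M(G)\ge n+2$; (c) if $G=K_{2,4}$, then $M(G)=n+1=7$; (d) $M(G)\ge n$; (e) $M(G)=n$ if and only if $G$ is an odd cycle.
   Context: All graphs are finite and simple. Let $f:V(G)\to\mathbb{Z}_{\ge 0}$. The game $(G,f)$ is played by Lister and Painter. In round $i$ Lister chooses, adaptively, a nonempty set $V_i\subseteq V(G)$ of marked vertices, and then Painter, seeing $V_1,\dots,V_i$, chooses an independent set $X_i\subseteq V_i$ whose vertices receive color $i$. A vertex that has been colored needs no further coloring, but may still be marked later. Painter wins if at the end every vertex has been colored. In the game with exactly $t$ rounds ($t$ is known to both players in advance), Lister must choose $V_1,\dots,V_t$ so that each vertex $v$ lies in exactly $f(v)$ of them; $G$ is $[f,t]$-paintable if Painter has a winning strategy in this game (vacuously true if no legal sequence of marked sets of length $t$ exists). In the unrestricted game the number of rounds is not fixed in advance and play continues until every vertex $v$ has been marked $f(v)$ times (never more); $G$ is $f$-paintable if Painter has a winning strategy in the unrestricted game. For the constant function $f\equiv k$ we say $k$-paintable and $[k,t]$-paintable. $M(G)$ is the maximum $t$ such that $G$ is not $[2,t]$-paintable. $P_k$ is the path with $k$ vertices and $C_n$ the cycle with $n$ vertices. $C_r\cdot P_k\cdot C_s$ denotes two cycles $C_r$ and $C_s$ connected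 by a path $P_k$: one endpoint of $P_k$ is a vertex of $C_r$, the other endpoint is a vertex of $C_s$, and there are no other common vertices; $k=1$ is allowed, in which case the two cycles share exactly one vertex. $\theta_{p,q,r}$ is the (simple) graph obtained from three disjoint paths with $p,q,r$ edges respectively by identifying all their beginnings to one vertex and all their ends to one vertex. *)

(* Defs.v *)
From mathcomp Require Import all_boot.

Set Implicit Arguments.
Unset Strict Implicit.
Unset Printing Implicit Defensive.

Record sgraph := SGraph {
  vertex :> finType;
  adj : rel vertex;
  adj_sym : symmetric adj;
  adj_irrefl : irreflexive adj
}.

Definition graph_iso (G H : sgraph) : Prop :=
  exists2 h : G -> H, bijective h & {mono h : x y / adj x y}.

Definition independent (G : sgraph) (X : {set G}) : bool :=
  [forall x in X, forall y in X, ~~ adj x y].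

(* A sequence [:: V_1; ...; V_t] of marked sets is a complete legal play of
   Lister when every V_i is nonempty and each v is marked exactly f v times. *)
Definition legal_play (G : sgraph) (f : G -> nat) (Vs : seq {set G}) : Prop :=
  (forall V : {set G}, V \in Vs -> V != set0) /\
  (forall v : G, count (fun V : {set G} => v \in V) Vs = f v).

(* A strategy maps the history [:: V_1; ...; V_i] to the set X_i. Since it is
   deterministic, it beats every adaptive Lister if and only if it beats every
   legal sequence of marked sets. *)
Definition strategy (G : sgraph) := seq {set G} -> {set G}.

(* Rounds are numbered from 0, so that V_(i+1) is [nth set0 Vs i]. The sets
   chosen by Painter may contain vertices that are already colored, which
   gives no advantage since subsets of independent sets are independent. *)
Definition painter_wins (G : sgraph) (sigma : strategy G)
    (Vs : seq {set G}) : Prop :=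
  (forall i, i < size Vs ->
     sigma (take i.+1 Vs) \subset nth set0 Vs i /\
     independent (sigma (take i.+1 Vs))) /\
  (forall v : G, exists2 i, i < size Vs & v \in sigma (take i.+1 Vs)).

Definition paintable (G : sgraph) (f : G -> nat) : Prop :=
  exists sigma : strategy G,
    forall Vs, legal_play f Vs -> painter_wins sigma Vs.

Definition paintable_in (G : sgraph) (f : G -> nat) (t : nat) : Prop :=
  exists sigma : strategy G,
    forall Vs, size Vs = t -> legal_play f Vs -> painter_wins sigma Vs.

Definition k_paintable (G : sgraph) (k : nat) : Prop :=
  paintable (fun _ : G => k).

Definition kt_paintable (G : sgraph) (k t : nat) : Prop :=
  paintable_in (fun _ : G => k) t.

(* "M(G) = m" *)
Definition is_M (G : sgraph) (m : nat) : Prop :=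
  ~ kt_paintable G 2 m /\ forall t, ~ kt_paintable G 2 t -> t <= m.

Definition consecutive (w : seq nat) (x y : nat) : bool :=
  infix [:: x; y] w || infix [:: y; x] w.

(* The graph on {0, ..., N-1} whose edges are the pairs of consecutive vertices
   of the walks in ws. *)
Section WalkGraph.
Variables (N : nat) (ws : seq (seq nat)).

Definition walk_adj : rel 'I_N :=
  fun i j => (i != j) && has (fun w => consecutive w i j) ws.

Fact walk_adj_sym : symmetric walk_adj.
Proof.
move=> i j; rewrite /walk_adj eq_sym; congr (_ && _).
by apply: eq_has => w; rewrite /consecutive orbC.
Qed.

Fact walk_adj_irrefl : irreflexive walk_adj.
Proof. by move=> i; rewrite /walk_adj eqxx. Qed.

Definition walk_graph : sgraph := SGraph walk_adj_sym walk_adj_irrefl.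
End WalkGraph.

(* The closed walk m, m+1, ..., m+n-1, m. *)
Definition closed_walk (m n : nat) : seq nat := rcons (iota m n) m.

(* Meaningful for n >= 3. *)
Definition cycle_graph (n : nat) : sgraph := walk_graph n [:: closed_walk 0 n].

(* C_r . P_k . C_s, for r, s >= 3 and k >= 1: the vertices of C_r are
   0, ..., r-1, those of P_k are r-1, ..., r+k-2, and those of C_s are
   r+k-2, ..., r+k+s-3. *)
Definition cycle_path_cycle (r k s : nat) : sgraph :=
  walk_graph (r + k + s - 2)
    [:: closed_walk 0 r; iota (r - 1) k; closed_walk (r + k - 2) s].

(* theta_{p,q,r}, for p, q, r >= 1 with at most one of them equal to 1: three
   paths from 0 to 1 whose internal vertices are p-1, q-1 and r-1 successive
   numbers starting from 2. *)
Definition theta_graph (p q r : nat) : sgraph :=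
  walk_graph (p + q + r - 1)
    [:: 0 :: rcons (iota 2 (p - 1)) 1;
        0 :: rcons (iota (p + 1) (q - 1)) 1;
        0 :: rcons (iota (p + q) (r - 1)) 1].

Section CompleteBipartite.
Variables m n : nat.

Definition bip_adj : rel ('I_m + 'I_n)%type := fun x y =>
  match x, y with
  | inl _, inr _ | inr _, inl _ => true
  | _, _ => false
  end.

Fact bip_adj_sym : symmetric bip_adj. Proof. by case=> ? []. Qed.

Fact bip_adj_irrefl : irreflexive bip_adj. Proof. by case. Qed.

Definition complete_bipartite : sgraph := SGraph bip_adj_sym bip_adj_irrefl.
End CompleteBipartite.

Definition is_odd_cycle (G : sgraph) : Prop :=
  exists l, [/\ 3 <= l, odd l & graph_iso G (cycle_graph l)].

(* Main.v *)
Require Import Defs.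
From mathcomp Require Import all_boot zify.

(** A round that marks [V] uses [#|V|] of the [2 * n] marks, where a single one
would have been enough for a round; call [#|V| - 1] its excess. In a game with
[t] rounds the excesses add up to [2 * n - t], so limiting Lister to few
excess marks is the same as forcing many rounds. This turns the game into the
budget game [safe e A D]: only uncolored vertices count, those of [A] have one
mark left and those of [D] two, and Lister pays the excess of his moves from a
budget [e], without any count of rounds.

A winning strategy of Painter in the budget game wins every play of excess at
most [e] ([safe_strategy]); with [e = 2 * n] this is every play. Conversely, if
Painter loses with [e < n], then Lister wins the game with [2 * n - e] rounds
([unsafe_not_kt_paintable]): moves with a single marked vertex do not help him
and can be left out, every other one costs at least one unit of the budget, and
so enough rounds are left to use up the remaining marks. Hence [M(G)] is [2 * n]
minus the least losing budget, as soon as that budget is less than [n].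

Lister's basic weapon is a path whose ends have one mark left and whose inner
vertices have two: marking the ends of an edge forces Painter to leave one of
them with a single mark. Such a path with [d] edges costs him [d], and only
[d - 1] if [d >= 3], by starting with an inner edge ([unsafe_path]). A cycle
hanging on a vertex with one mark left reduces to such a path ([unsafe_lollipop]).
From these come losing budgets at most [n - 2] for two cycles joined by a path
and for theta graphs, at most [n - 1] for [K_{2,4}] ([unsafe_two_lollipops],
[unsafe_touch], [unsafe_theta]), and [l] for an odd cycle of length [l]
([unsafe_odd_cycle]). They are stated inside an arbitrary graph, where each
vertex outside of the configuration only makes the budget smaller compared
with [n].

It remains to see that a graph that is not 2-paintable has a losing budget
less than [n], unless it is an odd cycle. If [n - 1] is a winning budget, every
odd cycle is a Hamilton cycle, and a chord of it would give a shorter one: the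
graph is an odd cycle as soon as it has one ([safe_is_odd_cycle]). Without odd
cycles, take a vertex set [U] that is minimal among those that lose with some
larger budget. It is connected and its degrees are at least 2, because Painter
can treat components and pendant vertices separately ([safe_union],
[safe_pendant]). Adding ears to a cycle inside [U] produces a winning
configuration of Lister, except when [U] is an even cycle or [K_{2,3}]; but on
those Painter wins with any budget ([safe_even_cycle], [safe_K2m]). This
contradiction is [bipartite_safe].

Finally [K_{2,4}] is won by Painter with budget 4 and an odd cycle with budget
[n - 1], which bounds [M] from above. For the odd cycle the least losing budget
is [n] itself, and a strategy of Lister in two moves gives the game with exactly
[n] rounds ([hamilton_odd_cycle]). *)

Set Implicit Arguments.
Unset Strict Implicit.
Unset Printing Implicit Defensive.

(** * The budget game *)
Section BudgetGame.
Variable G : sgraph.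
Implicit Types (A D U V X W K : {set G}) (x y v w : G) (e : nat).

Lemma independentP X :
  reflect {in X &, forall x y, ~~ adj x y} (independent X).
Proof.
apply: (iffP forall_inP) => [H x y xX yX | H x xX].
  by have /forall_inP := H x xX; apply.
by apply/forall_inP => y yX; apply: H.
Qed.

Lemma independentS X W : W \subset X -> independent X -> independent W.
Proof.
move=> /subsetP WX /independentP iX; apply/independentP => x y xW yW.
by apply: iX; apply: WX.
Qed.

(** Painter wins the budget game during its first [m] moves. She must color the
marked vertices of [A], which have no mark left afterwards; the marked vertices
of [D] that she leaves out join [A]. *)
Fixpoint safe_in (m e : nat) (A D : {set G}) : bool :=
  if m is m'.+1 then
    [forall V : {set G},
      [&& V \subset A :|: D, V != set0 & #|V| <= e.+1] ==>
      [exists X : {set G},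
        [&& independent X, V :&: A \subset X, X \subset V &
            safe_in m' (e.+1 - #|V|) ((A :\: V) :|: (V :\: X)) (D :\: V)]]]
  else true.

(** The number of marks left on uncolored vertices, which bounds the number of
moves still to come. *)
Definition weight A D := #|A| + #|D| * 2.

(** The number of moves allowed by [weight] is as good as infinitely many, see
[safeP]. *)
Definition safe e A D := safe_in (weight A D) e A D.

Lemma weight_answer A D V X (W := V :&: (A :|: D)) : V :&: A \subset X ->
  weight ((A :\: V) :|: (W :\: X)) (D :\: V) + #|W| <= weight A D.
Proof.
move=> VAX; rewrite /weight.
have h1 : #|(A :\: V) :|: (W :\: X)| <= #|A :\: V| + #|W :\: X|.
  by rewrite cardsU leq_subr.
have h2 : #|W :\: X| <= #|D :&: V|.
  apply/subset_leq_card/subsetP => x; rewrite !inE => /and3P[xX xV /orP[xA|->//]].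
  by move/subsetP: VAX => /(_ x); rewrite !inE xV xA => /(_ isT); rewrite (negPf xX).
have h3 := cardsID V A; have h4 := cardsID V D.
have h5 : #|W| <= #|A :&: V| + #|D :&: V|.
  rewrite /W setIUr ![V :&: _]setIC; exact: leq_card_setU.
clear -h1 h2 h3 h4 h5; lia.
Qed.

Lemma weight_move A D V X : V \subset A :|: D -> V != set0 ->
  V :&: A \subset X ->
  weight ((A :\: V) :|: (V :\: X)) (D :\: V) < weight A D.
Proof.
move=> /setIidPl VU V0 VAX; have := weight_answer D VAX; rewrite VU.
by apply: leq_trans; rewrite -addn1 leq_add2l card_gt0.
Qed.

Lemma weight_gt0 A D V : V \subset A :|: D -> V != set0 -> 0 < weight A D.
Proof.
move=> VU; rewrite -card_gt0 => V0.
have h : #|V| <= #|A| + #|D| by apply: leq_trans (leq_card_setU A D); apply: subset_leq_card.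
by rewrite /weight; lia.
Qed.

Lemma safe_in_fuel m k e A D :
  weight A D <= m -> weight A D <= k -> safe_in m e A D = safe_in k e A D.
Proof.
elim: m k e A D => [|m IHm] [|k] e A D //= hm hk.
- symmetry; apply/forallP => V; apply/implyP => /and3P[VU V0 _].
  by have := weight_gt0 VU V0; lia.
- apply/forallP => V; apply/implyP => /and3P[VU V0 _].
  by have := weight_gt0 VU V0; lia.
apply: eq_forallb => V; apply: implyb_id2l => /and3P[VU V0 _].
apply: eq_existsb => X; congr (_ && _); apply: andb_id2l => VAX.
congr (_ && _); have lt := weight_move VU V0 VAX.
by apply: IHm; lia.
Qed.

Lemma safe_in_weight m e A D : weight A D <= m -> safe_in m e A D = safe e A D.
Proof. by move=> h; apply: safe_in_fuel. Qed.

Lemma safeP e A D :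
  reflect (forall V, V \subset A :|: D -> V != set0 -> #|V| <= e.+1 ->
             exists X, [/\ independent X, V :&: A \subset X, X \subset V &
               safe (e.+1 - #|V|) ((A :\: V) :|: (V :\: X)) (D :\: V)])
          (safe e A D).
Proof.
rewrite -(safe_in_weight e (leqnSn (weight A D))) /=.
apply: (iffP forallP) => H V.
  move=> VU V0 Ve; have /implyP := H V; rewrite VU V0 Ve => /(_ isT).
  move=> /existsP[X /and4P[iX VAX XV s]]; exists X; split=> //.
  by move: s; rewrite safe_in_weight // ltnW // weight_move.
apply/implyP => /and3P[VU V0 Ve]; have [X [iX VAX XV s]] := H V VU V0 Ve.
apply/existsP; exists X; rewrite iX VAX XV /= safe_in_weight //.
by rewrite ltnW // weight_move.
Qed.

(** The same answers work: fewer vertices put fewer constraints on Painter, and a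
smaller budget leaves Lister fewer moves. *)
Lemma safe_mono e e' A A' D D' :
  e' <= e -> A' \subset A -> D' \subset D -> safe e A D -> safe e' A' D'.
Proof.
have [m] := ubnP (weight A D).
elim: m e e' A A' D D' => // m IHm e e' A A' D D' lem ee AA DD /safeP sAD.
apply/safeP => V VU V0 Ve.
have VU' : V \subset A :|: D by apply: subset_trans VU (setUSS AA DD).
have [|X [iX VAX XV s]] := sAD V VU' V0; first by lia.
exists X; split=> //; first by apply: subset_trans VAX; apply: setIS.
apply: IHm s; last exact: setSD.
- by have := weight_move VU' V0 VAX; lia.
- by lia.
- by apply: setSU; apply: setSD.
Qed.

(** Marks on vertices outside of [A :|: D] cost Lister budget without any effect,
so Painter can answer an arbitrary set through its trace on [A :|: D]. *)
Lemma safe_answer e A D V : safe e A D -> V != set0 -> #|V| <= e.+1 ->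
  exists X, [/\ independent X, V :&: A \subset X, X \subset V :&: (A :|: D) &
    safe (e.+1 - #|V|) ((A :\: V) :|: ((V :&: (A :|: D)) :\: X)) (D :\: V)].
Proof.
move=> s V0 Ve; set W := V :&: (A :|: D).
have W_V : #|W| <= #|V| by apply/subset_leq_card/subsetIl.
have AW : A :\: V = A :\: W.
  by apply/setP => x; rewrite !inE; case: (x \in A); rewrite ?andbT ?andbF.
have DW : D :\: V = D :\: W.
  apply/setP => x; rewrite !inE; case: (x \in D);
  by rewrite ?orbT ?andbT ?andbF.
have [W0|W0] := eqVneq W set0.
  exists set0; split.
  - by apply/independentP => x y; rewrite inE.
  - by rewrite -W0 /W; apply: setIS; apply: subsetUl.
  - exact: sub0set.
  rewrite AW DW W0 !setD0 setU0; apply: safe_mono s => //.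
  by move: V0; rewrite -card_gt0; lia.
have /safeP/(_ W) := s; rewrite subsetIr W0 => /(_ isT isT).
case=> [|X [iX WAX XW sX]]; first lia.
exists X; split=> //.
  apply: subset_trans WAX; apply/subsetP => x; rewrite !inE.
  by case/andP=> -> ->.
by rewrite AW DW; apply: safe_mono sX => //; lia.
Qed.

End BudgetGame.

(** * From the budget game to the painting game *)
Section Transfer.
Variable G : sgraph.
Implicit Types (A D U V X W K : {set G}) (x y v w : G) (e : nat).
Implicit Types (Vs : seq {set G}) (f : G -> nat).

Definition answer e A D V : {set G} :=
  odflt set0 [pick X : {set G} |
    [&& independent X, V :&: A \subset X, X \subset V :&: (A :|: D) &
        safe (e.+1 - #|V|) ((A :\: V) :|: ((V :&: (A :|: D)) :\: X)) (D :\: V)]].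

Lemma answerP e A D V (X := answer e A D V) :
  safe e A D -> V != set0 -> #|V| <= e.+1 ->
  [/\ independent X, V :&: A \subset X, X \subset V :&: (A :|: D) &
    safe (e.+1 - #|V|) ((A :\: V) :|: ((V :&: (A :|: D)) :\: X)) (D :\: V)].
Proof.
move=> s V0 Ve; rewrite /X /answer; case: pickP => [Y /and4P[]//|no].
have [Y [iY h1 h2 h3]] := safe_answer s V0 Ve.
by have := no Y; rewrite iY h1 h2 h3.
Qed.

(** Painter's answers to a whole play, carrying the state of the budget game along
with the history. *)
Fixpoint answers e A D Vs : seq {set G} :=
  if Vs is V :: Vs' then
    let X := answer e A D V in
    X :: answers (e.+1 - #|V|) ((A :\: V) :|: ((V :&: (A :|: D)) :\: X))
                 (D :\: V) Vs'
  else [::].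

Lemma answers_take k e A D Vs :
  answers e A D (take k Vs) = take k (answers e A D Vs).
Proof.
by elim: Vs k e A D => [|V Vs IH] [|k] e A D //=; rewrite IH.
Qed.

Lemma size_answers e A D Vs : size (answers e A D Vs) = size Vs.
Proof. by elim: Vs e A D => //= V Vs IH e A D; rewrite IH. Qed.

Lemma last_answers e A D Vs i : i < size Vs ->
  last set0 (answers e A D (take i.+1 Vs)) = nth set0 (answers e A D Vs) i.
Proof.
move=> lt; rewrite answers_take (last_nth set0) size_take size_answers.
have -> : (if i.+1 < size Vs then i.+1 else size Vs) = i.+1.
  by case: ifP => //; lia.
by rewrite (take_nth set0) ?size_answers //= nth_rcons size_take size_answers lt ltnn eqxx.
Qed.

(** The total excess of a play never exceeds the budget, because the rounds still
to come have nonnegative excess. *)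
Lemma answers_sound e A D Vs i :
  safe e A D -> {in Vs, forall V, V != set0} ->
  \sum_(V <- Vs) #|V| <= e + size Vs -> i < size Vs ->
  nth set0 (answers e A D Vs) i \subset nth set0 Vs i /\
  independent (nth set0 (answers e A D Vs) i).
Proof.
elim: Vs e A D i => //= V Vs IH e A D i s V0 le lt.
rewrite big_cons in le.
have V0' : V != set0 by apply: V0; rewrite mem_head.
have Vs0 : {in Vs, forall V, V != set0}.
  by move=> W WVs; apply: V0; rewrite inE WVs orbT.
have Vs_ge : size Vs <= \sum_(W <- Vs) #|W|.
  rewrite -sum1_size; rewrite !big_seq; apply: leq_sum => W WVs.
  by rewrite card_gt0 Vs0.
have [|iX _ XV sX] := answerP s V0'; first by lia.
case: i lt => [|i] lt /=.
  by split=> //; apply: subset_trans XV (subsetIl _ _).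
apply: IH => //; lia.
Qed.

(** The state keeps the promise that a vertex of [A] is marked at least once more
and a vertex of [D] at least twice more, so none can be left uncolored when the
play ends. *)
Lemma answers_complete e A D Vs v :
  safe e A D -> {in Vs, forall V, V != set0} ->
  \sum_(V <- Vs) #|V| <= e + size Vs -> v \in A :|: D ->
  (v \in A -> 0 < count (fun V : {set G} => v \in V) Vs) ->
  (v \in D -> 1 < count (fun V : {set G} => v \in V) Vs) ->
  exists2 i, i < size Vs & v \in nth set0 (answers e A D Vs) i.
Proof.
elim: Vs e A D => [|V Vs IH] e A D s V0 le vU cA cD.
  by move: vU; rewrite inE => /orP[/cA|/cD].
rewrite big_cons /= in le.
have V0' : V != set0 by apply: V0; rewrite mem_head.
have Vs0 : {in Vs, forall V, V != set0}.
  by move=> W WVs; apply: V0; rewrite inE WVs orbT.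
have Vs_ge : size Vs <= \sum_(W <- Vs) #|W|.
  rewrite -sum1_size; rewrite !big_seq; apply: leq_sum => W WVs.
  by rewrite card_gt0 Vs0.
have [|iX AX XV sX] := answerP s V0'; first by lia.
have [vX|vX] := boolP (v \in answer e A D V); first by exists 0.
have vVA : v \in V -> v \notin A.
  move=> vV; apply: contra vX => vA; apply: (subsetP AX).
  by rewrite inE vV.
case: (IH _ _ _ sX Vs0 _) => [||vA'|vD'|i lt vi].
- by clear -le; lia.
- move: vU; rewrite !inE (negPf vX).
  by case: (v \in V); case: (v \in A); case: (v \in D).
- move: vA'; rewrite !inE (negPf vX) /=.
  case: (boolP (v \in V)) => vV /=.
    by rewrite (negPf (vVA vV)) /= => vD; have := cD vD; rewrite /= vV.
  by rewrite orbF => /cA; rewrite /= (negPf vV).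
- by move: vD'; rewrite inE => /andP[/negPf vV /cD]; rewrite /= vV.
by exists i.+1.
Qed.

Lemma card_sum_mem V : #|V| = \sum_v (v \in V).
Proof. by rewrite -sum1_card big_mkcond; apply: eq_bigr => v _; case: ifP. Qed.

Lemma sum_card_marks Vs :
  \sum_(V <- Vs) #|V| = \sum_v count (fun V : {set G} => v \in V) Vs.
Proof.
elim: Vs => [|V Vs IH]; first by rewrite big_nil big1.
rewrite big_cons IH /= big_split /=; congr (_ + _).
exact: card_sum_mem.
Qed.

Lemma sum_card_legal f Vs : legal_play f Vs -> \sum_(V <- Vs) #|V| = \sum_v f v.
Proof.
by case=> _ cnt; rewrite sum_card_marks; apply: eq_bigr => v _; rewrite cnt.
Qed.

(** A play of all [2 * #|G|] marks in [size Vs] rounds has excess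
[2 * #|G| - size Vs]. *)
Lemma safe_strategy e : safe e set0 [set: G] ->
  exists sigma : strategy G, forall Vs,
    legal_play (fun _ => 2) Vs -> 2 * #|G| <= e + size Vs ->
    painter_wins sigma Vs.
Proof.
move=> s; exists (fun h => last set0 (answers e set0 [set: G] h)) => Vs leg le.
have le' : \sum_(V <- Vs) #|V| <= e + size Vs.
  by rewrite (sum_card_legal leg) sum_nat_const mulnC.
case: leg => V0 cnt; split=> [i lt|v].
  by rewrite last_answers //; apply: answers_sound.
case: (@answers_complete e set0 setT Vs v) => //.
- by rewrite !inE.
- by rewrite inE.
- by rewrite cnt.
by move=> i lt vi; exists i; rewrite ?last_answers.
Qed.

Lemma safe_k_paintable : safe (2 * #|G|) set0 [set: G] -> k_paintable G 2.
Proof.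
move=> /safe_strategy[sigma H]; exists sigma => Vs leg; apply: H => //.
exact: leq_addr.
Qed.

Lemma safe_kt_paintable t :
  safe (2 * #|G| - t) set0 [set: G] -> kt_paintable G 2 t.
Proof.
move=> /safe_strategy[sigma H]; exists sigma => Vs sz leg; apply: H => //; lia.
Qed.

(** Lister can spread his marks over [R] rounds as soon as [R] lies between the
largest number of marks on a vertex and the total number. Each round marks
the vertices that need to be marked in every round that is left, or any one
vertex if there are none. *)
Lemma legal_completion f R : (forall v, f v <= R) -> R <= \sum_v f v ->
  exists2 Vs, size Vs = R & legal_play f Vs.
Proof.
elim: R f => [|R IH] f fR Rf.
  exists [::] => //; split=> // v.
  by have := fR v; rewrite leqn0 => /eqP->.
suff [V [V0 Vpos Vtop Vsum]] : exists V : {set G},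
    [/\ V != set0, {in V, forall v, 0 < f v}, forall v, f v = R.+1 -> v \in V &
        R + #|V| <= \sum_v f v].
  have sumV : \sum_v (f v - (v \in V)) + #|V| = \sum_v f v.
    rewrite card_sum_mem -big_split /=; apply: eq_bigr => v _.
    by case: (boolP (v \in V)) => [/Vpos|_]; rewrite /= ?subn0 ?addn0 // => /subnK.
  case: (IH (fun v => f v - (v \in V))) => [v||Vs sz [Vs0 cnt]].
  - have := fR v; rewrite leq_eqVlt => /orP[/eqP fv|]; last by lia.
    by rewrite Vtop // fv; lia.
  - lia.
  exists (V :: Vs) => /=; first by rewrite sz.
  split=> [W|v /=]; first by rewrite inE => /orP[/eqP->|/Vs0].
  rewrite cnt; case: (boolP (v \in V)) => [/Vpos|] /=; lia.
(* These vertices must be marked now, as they need all the rounds left. *)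
pose W := [set v | f v == R.+1].
have [W0|W0] := eqVneq W set0; last first.
  exists W; split=> // [v|v fv|]; first by rewrite inE => /eqP->.
    by rewrite inE fv.
  have : \sum_(v in W) R.+1 <= \sum_v f v.
    rewrite [leqRHS](bigID (mem W)) /=; apply: leq_trans (leq_addr _ _).
    by apply: leq_sum => v; rewrite inE => /eqP->.
  by rewrite sum_nat_const; move: W0; rewrite -card_gt0; nia.
have [v fv] : exists v, 0 < f v.
  apply/existsP; apply: contraLR Rf; rewrite negb_exists => /forallP H.
  by rewrite big1 // => v _; apply/eqP; rewrite -leqn0 leqNgt H.
exists [set v]; split; rewrite ?cards1.
- by apply/set0Pn; exists v; rewrite inE.
- by move=> w; rewrite inE => /eqP->.
- move=> w fw; have : w \in W by rewrite inE fw.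
  by rewrite W0 in_set0.
- by lia.
Qed.

(** Painter's goal in the middle of a game, when only [U] is uncolored: [sigma] and
[Vs] are the strategy and the play from that point on. *)
Definition wins_on (sigma : strategy G) U Vs :=
  (forall i, i < size Vs ->
     sigma (take i.+1 Vs) \subset nth set0 Vs i /\
     independent (sigma (take i.+1 Vs))) /\
  {in U, forall v, exists2 i, i < size Vs & v \in sigma (take i.+1 Vs)}.

Lemma wins_on_cons (sigma : strategy G) U V Vs : wins_on sigma U (V :: Vs) ->
  [/\ sigma [:: V] \subset V, independent (sigma [:: V]) &
      wins_on (fun h => sigma (V :: h)) (U :\: sigma [:: V]) Vs].
Proof.
case=> H1 H2; have [|XV iX] := H1 0; first by [].
rewrite /= take0 in XV iX; split=> //.
split=> [i lt|v]; first by have := H1 i.+1 lt.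
rewrite inE => /andP[vX /H2[[|i] lt]]; first by rewrite /= take0 (negPf vX).
by exists i.
Qed.

Lemma exhausted_uncolored (sigma : strategy G) U f Vs v :
  legal_play f Vs -> f v = 0 -> v \in U -> ~ wins_on sigma U Vs.
Proof.
move=> [_ cnt] fv vU [H1 /(_ v vU)[i lt vX]].
have [/subsetP/(_ v vX) vV _] := H1 i lt.
have : has (fun V : {set G} => v \in V) Vs.
  by apply/hasP; exists (nth set0 Vs i) => //; apply: mem_nth.
by rewrite has_count cnt fv.
Qed.

(** Lister follows his winning moves of the budget game. A move with a single
vertex is skipped: Painter may color that vertex, so that dropping it from the
state leaves a losing state. The other moves cost at least 1, hence [e]
bounds the number of rounds used, and [f v + e <= R] makes sure that the
marks left when Painter has lost still fit into the remaining rounds. *)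
Lemma unsafe_lister e A D : ~~ safe e A D ->
  forall (sigma : strategy G) U f R,
    [disjoint A & D] -> A :|: D \subset U ->
    {in A, forall v, f v = 1} -> {in D, forall v, f v = 2} ->
    (forall v, f v + e <= R) -> R + e <= \sum_v f v ->
  exists Vs, [/\ size Vs = R, legal_play f Vs & ~ wins_on sigma U Vs].
Proof.
have [m] := ubnP (weight A D).
elim: m e A D => // m IHm e A D wt uns sigma U f R dAD AU fA fD fR Rf.
have [V [VU V0 Ve noX]] : exists V : {set G},
  [/\ V \subset A :|: D, V != set0, #|V| <= e.+1 & forall X,
     independent X -> V :&: A \subset X -> X \subset V ->
     ~~ safe (e.+1 - #|V|) ((A :\: V) :|: (V :\: X)) (D :\: V)].
  move: uns; have wl := leqnn (weight A D).
  rewrite -(safe_in_weight e (leqnSn (weight A D))) /= => /forallPn[V].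
  rewrite negb_imply => /andP[/and3P[VU V0 Ve] /existsPn no].
  exists V; split=> // X iX AX XV; have := no X.
  rewrite iX AX XV /= safe_in_weight //.
  by rewrite ltnW // weight_move.
(* A move with a single vertex is not played. *)
have [V1|V1] := leqP #|V| 1.
  have cV : #|V| = 1 by apply/eqP; rewrite eqn_leq V1 card_gt0.
  have /eqP/cards1P[v Vv] := cV.
  have iV : independent V.
    by apply/independentP => x y; rewrite Vv !inE => /eqP-> /eqP->; rewrite adj_irrefl.
  have := noX V iV (subsetIl _ _) (subxx _).
  rewrite setDv setU0 cV subn1 /= => uns'; apply: (IHm _ _ _ _ uns').
  - have := weight_move VU V0 (subsetIl V A); rewrite setDv setU0; lia.
  - exact: disjointWl (subsetDl _ _) (disjointWr (subsetDl _ _) dAD).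
  - by apply: subset_trans AU; apply: setUSS; apply: subsetDl.
  - by move=> x; rewrite inE => /andP[_ /fA].
  - by move=> x; rewrite inE => /andP[_ /fD].
  - exact: fR.
  - exact: Rf.
have Vpos v : v \in V -> 0 < f v.
  by move=> vV; move/subsetP: VU => /(_ v vV); rewrite inE => /orP[/fA->|/fD->].
pose f' v := f v - (v \in V).
have sumV : \sum_v f' v + #|V| = \sum_v f v.
  rewrite card_sum_mem -big_split /= /f'; apply: eq_bigr => v _.
  by case: (boolP (v \in V)) => [/Vpos|_]; rewrite /= ?subn0 ?addn0 // => /subnK.
have legV Vs : legal_play f' Vs -> legal_play f (V :: Vs).
  case=> Vs0 cnt; split=> [W|v /=]; first by rewrite inE => /orP[/eqP->|/Vs0].
  rewrite cnt /f'; case: (boolP (v \in V)) => [/Vpos|] /=; lia.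
have f'R v : f' v + (e.+1 - #|V|) <= R.-1.
  by have := fR v; rewrite /f'; lia.
have R0 : R = R.-1.+1.
  by move: V0 => /set0Pn[v /Vpos]; have := fR v; lia.
have Rf' : R.-1 + (e.+1 - #|V|) <= \sum_v f' v by lia.
have [Vs szVs legVs] : exists2 Vs, size Vs = R.-1 & legal_play f' Vs.
  by apply: legal_completion => [v|]; [have := f'R v|]; lia.
set X := sigma [:: V].
have [XV|XV] := boolP (X \subset V); last first.
  exists (V :: Vs); split; [by rewrite /= szVs|exact: legV|].
  by move=> /wins_on_cons[]; rewrite -/X (negPf XV).
have [iX|iX] := boolP (independent X); last first.
  exists (V :: Vs); split; [by rewrite /= szVs|exact: legV|].
  by move=> /wins_on_cons[_]; rewrite -/X (negPf iX).
have [AX|] := boolP (V :&: A \subset X); last first.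
  move=> /subsetPn[v]; rewrite inE => /andP[vV vA] vX.
  exists (V :: Vs); split; [by rewrite /= szVs|exact: legV|].
  move=> /wins_on_cons[_ _]; apply: (exhausted_uncolored (v := v) legVs).
    by rewrite /f' vV fA.
  by rewrite -/X !inE vX (subsetP AU) // inE vA.
have VXD x : x \in V -> x \notin X -> x \in D.
  move=> xV xX; move/subsetP: VU => /(_ x xV); rewrite inE => /orP[xA|//].
  by move/subsetP: AX => /(_ x); rewrite inE xV xA => /(_ isT); rewrite (negPf xX).
have [|||||Vs' [sz' leg' no']] := IHm _ _ _ _ (noX X iX AX XV)
    (fun h => sigma (V :: h)) (U :\: X) f' R.-1 _ _ _ _ f'R Rf'.
- by have := weight_move VU V0 AX; lia.
- rewrite -setI_eq0; apply/eqP/setP => x; rewrite !inE.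
  case: (boolP (x \in V)) => //= _; rewrite ?andbF ?orbF //=.
  apply/negbTE/negP => /andP[xA xD].
  by move: dAD; rewrite -setI_eq0 => /eqP/setP/(_ x); rewrite !inE xA xD.
- apply/subsetP => x; rewrite !inE => xAD.
  have xU : x \in A :|: D.
    move: xAD; rewrite inE => /orP[/orP[/andP[_ ->]//|/andP[xX xV]]|/andP[_ ->]].
      by rewrite (VXD x) ?orbT.
    by rewrite orbT.
  rewrite (subsetP AU) // andbT; apply/negP => xX.
  by move: xAD; rewrite xX (subsetP XV _ xX).
- move=> x; rewrite !inE /f' => /orP[/andP[/negPf-> /fA->]//|/andP[xX xV]].
  by rewrite xV fD ?VXD.
- by move=> x; rewrite !inE /f' => /andP[/negPf-> /fD->].
exists (V :: Vs'); split; [by rewrite /= sz'|exact: legV|].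
by case/wins_on_cons.
Qed.

Lemma unsafe_not_kt_paintable e : ~~ safe e set0 [set: G] -> e < #|G| ->
  ~ kt_paintable G 2 (2 * #|G| - e).
Proof.
move=> uns lt [sigma H].
have [||||||Vs [sz leg no]] :=
   unsafe_lister uns sigma (U := setT) (f := fun _ => 2) (R := 2 * #|G| - e).
- by rewrite -setI_eq0 set0I.
- exact: subsetT.
- by move=> v; rewrite inE.
- by [].
- by move=> v; lia.
- have -> : \sum_(v : G) 2 = 2 * #|G| by rewrite sum_nat_const mulnC.
  by lia.
apply: no; case: (H Vs sz leg) => H1 H2; split=> // v _; exact: H2.
Qed.

End Transfer.

(** * Winning configurations for Lister *)
Section Lister.
Variable G : sgraph.
Local Notation adj := (@adj G).
Implicit Types (A D U V X W K : {set G}) (x y z u v w : G) (e : nat).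
Implicit Types (p q c : seq G).

Lemma unsafe_step e A D V : V \subset A :|: D -> V != set0 -> #|V| <= e.+1 ->
  (forall X, independent X -> V :&: A \subset X -> X \subset V ->
     ~~ safe (e.+1 - #|V|) ((A :\: V) :|: (V :\: X)) (D :\: V)) ->
  ~~ safe e A D.
Proof.
move=> VU V0 Ve H; apply/negP => /safeP/(_ V VU V0 Ve)[X [iX AX XV]].
exact/negP/H.
Qed.

Lemma unsafe_mono e e' A A' D D' :
  e' <= e -> A' \subset A -> D' \subset D -> ~~ safe e' A' D' -> ~~ safe e A D.
Proof. by move=> ee AA DD; apply: contra; apply: safe_mono. Qed.

Lemma adj_neq x y : adj x y -> x != y.
Proof. by move=> xy; apply: contraL xy => /eqP->; rewrite adj_irrefl. Qed.

Lemma card_edge x y : adj x y -> #|[set x; y]| = 2.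
Proof. by move=> /adj_neq ne; rewrite cards2 ne. Qed.

Lemma independent_edge X x y : independent X -> adj x y ->
  x \notin X \/ y \notin X.
Proof.
move=> /independentP iX xy; have [xX|] := boolP (x \in X); last by left.
by right; apply: contraL xy => yX; apply: iX.
Qed.

(** Painter cannot color both ends of an edge, and the end left out has one mark
less. If that end was in [A] it is lost, so that nothing has to be checked. *)
Lemma unsafe_edge e A D u w :
  adj u w -> u \in A :|: D -> w \in A :|: D ->
  (u \notin A ->
     ~~ safe e (u |: A :\: [set u; w]) (D :\: [set u; w])) ->
  (w \notin A ->
     ~~ safe e (w |: A :\: [set u; w]) (D :\: [set u; w])) ->
  ~~ safe e.+1 A D.
Proof.
move=> uw uU wU Hu Hw; apply: (@unsafe_step _ _ _ [set u; w]).
- by apply/subsetP => z /set2P[] ->.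
- by apply/set0Pn; exists u; rewrite set21.
- by rewrite card_edge.
move=> X iX /subsetP AX XV; rewrite card_edge //.
have notA z : z \in [set u; w] -> z \notin X -> z \notin A.
  by move=> zV; apply: contra => zA; apply: AX; rewrite inE zV.
have main z : z \in [set u; w] -> z \notin X ->
    ~~ safe e (z |: A :\: [set u; w]) (D :\: [set u; w]) ->
    ~~ safe (e.+2 - 2) (A :\: [set u; w] :|: [set u; w] :\: X)
        (D :\: [set u; w]).
  move=> zV zX; apply: unsafe_mono => //; first by rewrite !subSS subn0.
  by rewrite subUset subsetUl andbT sub1set inE [in X in _ || X]inE zX zV orbT.
case: (independent_edge iX uw) => zX.
  by apply: (main u) => //; [rewrite set21 | apply: Hu; apply: notA; rewrite ?set21].
by apply: (main w) => //; [rewrite set22 | apply: Hw; apply: notA; rewrite ?set22].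
Qed.

Lemma unsafe_adj e A D x y :
  adj x y -> x \in A -> y \in A -> 0 < e -> ~~ safe e A D.
Proof.
by case: e => // e xy xA yA _; apply: (unsafe_edge xy); rewrite ?inE ?xA ?yA.
Qed.

(** Marking the first edge forces Painter to color [x], because [x] has its last
mark; the next vertex is then the new end of a shorter path. *)
Lemma unsafe_path_long e A D x q z :
  path adj x (rcons q z) -> uniq (x :: rcons q z) -> x \in A -> z \in A ->
  {subset q <= D} -> size q < e -> ~~ safe e A D.
Proof.
elim: q e A D x => [|y q IH] [|e] A D x //= xq un xA zA qD le.
  move: xq; rewrite andbT => xz.
  by apply: (unsafe_edge xz); rewrite ?inE ?xA ?zA.
case/andP: xq => xy yq.
have yD : y \in D by apply: qD; rewrite mem_head.
apply: (unsafe_edge xy); rewrite ?inE ?xA ?yD ?orbT // => yA.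
move: un; rewrite !inE !mem_rcons !inE !negb_or -!andbA.
case/and5P => xy' xz xnq yz /andP[ynq unq].
apply: IH yq _ _ _ _ le.
- by rewrite /= mem_rcons inE negb_or yz ynq.
- by rewrite setU11.
- by rewrite !inE zA negb_or (eq_sym z x) xz (eq_sym z y) yz orbT.
move=> t tq; rewrite !inE (qD t) ?inE ?tq ?orbT // andbT negb_or.
by apply/andP; split; apply: contraTneq tq => ->.
Qed.

(** With two inner vertices, Lister starts with the edge between the first two of
them. If the first one is left out, it is adjacent to [x] and one more move
wins; if the second one is left out, the path has become shorter by two edges. *)
Lemma unsafe_path e A D x q z :
  path adj x (rcons q z) -> uniq (x :: rcons q z) -> x \in A -> z \in A ->
  {subset q <= D} -> size q < e + (1 < size q) -> ~~ safe e A D.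
Proof.
case: q => [|y [|y' q]] xq un xA zA qD le.
- by apply: unsafe_path_long xq un xA zA qD _; rewrite addn0 in le.
- by apply: unsafe_path_long xq un xA zA qD _; rewrite addn0 in le.
case: e le => [|e] le; first by clear -le; rewrite /= in le; lia.
have yD : y \in D by apply: qD; rewrite !inE eqxx.
have y'D : y' \in D by apply: qD; rewrite !inE eqxx orbT.
move: xq un => /= /and3P[xy yy' y'q]; rewrite !inE !mem_rcons !inE !negb_or.
rewrite -!andbA => /and5P[ne1 ne2 ne3 ne4 /and5P[ne5 ne6 ne7 ne8 /andP[ne9 unq]]].
apply: (unsafe_edge yy'); rewrite ?inE ?yD ?y'D ?orbT // => yA.
  apply: (@unsafe_path_long _ _ _ x [::] y) => //=.
  - by rewrite xy.
  - by rewrite !inE ne1.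
  - by rewrite !inE xA negb_or ne1 ne2 orbT.
  - by rewrite setU11.
  by clear -le; rewrite /= in le; lia.
apply: (@unsafe_path_long _ _ _ y' q z) => //=.
- by rewrite mem_rcons inE negb_or ne8 ne9.
- by rewrite setU11.
- by rewrite !inE zA negb_or (eq_sym z y) ne6 (eq_sym z y') ne8 orbT.
- move=> t tq; rewrite !inE (qD t) ?inE ?tq ?orbT // andbT negb_or.
  by apply/andP; split; apply: contraTneq tq => ->.
by clear -le; rewrite /= in le; lia.
Qed.

Lemma path_rev x q z : path adj x (rcons q z) -> path adj z (rcons (rev q) x).
Proof.
have := rev_path adj x (rcons q z).
rewrite last_rcons belast_rcons rev_cons => ->.
by rewrite (eq_path (e' := adj)) // => a b; rewrite adj_sym.
Qed.

(** [p] is the stick and [last x p :: c] the cycle at its end. Marking the first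
edge of [c] leaves one of its ends with a single mark, and the stick continues
to that end around one side of the cycle or the other. *)
Lemma unsafe_lollipop_path e A D x p c :
  path adj x p -> path adj (last x p) (rcons c (last x p)) ->
  uniq (x :: p ++ c) -> 2 < size c -> x \in A -> {subset p ++ c <= D} ->
  size p + size c <= e + (0 < size p) -> ~~ safe e A D.
Proof.
case: c => [|y1 [|y2 c]] // px pc un sc xA pD.
case: e => [|e] le; first by clear -le sc; rewrite /= in sc le; lia.
have y1D : y1 \in D by apply: pD; rewrite mem_cat !inE eqxx !orbT.
have y2D : y2 \in D by apply: pD; rewrite mem_cat !inE eqxx !orbT.
move: pc => /= /and3P[wy1 y1y2 y2c].
move: un; rewrite /= cat_uniq mem_cat !inE /= !inE !negb_or -!andbA.
case/and5P=> ne1 ne2 ne3 ne4 /and5P[unp ne5 ne6 ne7 /and4P[ne8 ne9 ne10 unc]].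
have ne5' : y1 \notin p by exact: ne5.
apply: (unsafe_edge y1y2); rewrite ?inE ?y1D ?y2D ?orbT // => yA.
  apply: (@unsafe_path _ _ _ x p y1).
  - by rewrite rcons_path px.
  - by rewrite /= mem_rcons inE negb_or ne2 ne1 rcons_uniq ne5' unp.
  - by rewrite !inE xA negb_or ne2 ne3 orbT.
  - by rewrite setU11.
  - move=> t tp; rewrite !inE (pD t) ?mem_cat ?tp // andbT negb_or.
    by apply/andP; split; apply: contraTneq tp => ->.
  by clear -le sc; move: le sc; rewrite /=; case: (size p) => [|[|k]] /=; lia.
apply: (@unsafe_path _ _ _ x (p ++ rev c) y2).
- by rewrite rcons_cat cat_path px; apply: path_rev.
- rewrite /= mem_rcons inE negb_or ne3 mem_cat mem_rev negb_or ne1 ne4 /=.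
  rewrite rcons_uniq mem_cat mem_rev negb_or ne6 ne10 cat_uniq unp rev_uniq unc.
  by rewrite has_rev ne7.
- by rewrite !inE xA negb_or ne2 ne3 orbT.
- by rewrite setU11.
- move=> t; rewrite mem_cat mem_rev => tpc.
  have tD : t \in D by apply: pD; rewrite mem_cat !inE; case/orP: tpc => ->; rewrite ?orbT.
  rewrite !inE tD andbT negb_or.
  by apply/andP; split; apply: contraTneq tpc => ->; rewrite negb_or ?ne5' ?ne9 ?ne6 ?ne10.
by clear -le sc; move: le sc; rewrite /= size_cat size_rev; case: (size p) => [|[|k]] /=; lia.
Qed.

Lemma unsafe_lollipop e A D x p c :
  path adj x p -> ucycle adj c -> last x p \in c -> uniq (belast x p ++ c) ->
  3 < size c -> x \in A -> {subset p <= D} ->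
  {in c, forall y, y != x -> y \in D} ->
  size p + size c <= (e + (0 < size p)).+1 -> ~~ safe e A D.
Proof.
move=> px /andP[cc uc] wc un sc xA pD cD le.
have [i c' rot_c] := rot_to wc.
have memc' : last x p :: c' =i c by move=> y; rewrite -rot_c mem_rot.
have szc : size c = (size c').+1 by rewrite -(size_rot i) rot_c.
have perm : perm_eq (belast x p ++ c) (x :: p ++ c').
  rewrite -cat_cons lastI cat_rcons perm_cat2l -rot_c perm_sym.
  by rewrite perm_rot.
apply: (@unsafe_lollipop_path _ _ _ x p c') => //.
- by have := cc; rewrite -(rot_cycle i) rot_c.
- by rewrite -(perm_uniq perm).
- by rewrite szc in sc.
- move=> t; rewrite mem_cat => /orP[/pD//|tc'].
  apply: cD; first by rewrite -memc' inE tc' orbT.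
  have : uniq (x :: p ++ c') by rewrite -(perm_uniq perm).
  rewrite /= mem_cat negb_or => /andP[/andP[_ xc'] _].
  by apply: contraNneq xc' => <-.
by rewrite szc addnS in le.
Qed.

(** A path from [x] that ends on a cycle [c] of length at least 4, which it meets
only there. *)
Definition lollipop x p c :=
  [&& path adj x p, ucycleb adj c, last x p \in c, uniq (belast x p ++ c) &
      3 < size c].

(** After the edge [u]-[w] is marked, the end that Painter leaves out has one mark
and is the tip of a lollipop that avoids the other end. *)
Lemma unsafe_two_lollipops e u w p1 c1 p2 c2 :
  adj u w -> lollipop u p1 c1 -> lollipop w p2 c2 ->
  w \notin p1 ++ c1 -> u \notin p2 ++ c2 ->
  size p1 + size c1 <= e + (0 < size p1) ->
  size p2 + size c2 <= e + (0 < size p2) ->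
  ~~ safe e set0 [set: G].
Proof.
move=> uw /and5P[pu cyc1 w1 un1 sc1] /and5P[pw cyc2 w2 un2 sc2] nw nu le1 le2.
case: e le1 le2 => [|e] le1 le2; first by clear -le1 sc1; lia.
have aux t p c : lollipop t p c -> {in p, forall s, s != t}.
  case/and5P=> _ _ lc un _ s sp; apply: contraTneq un => st.
  case/lastP: p sp lc => [|p l] //; rewrite st mem_rcons inE.
  rewrite last_rcons belast_rcons cat_uniq => /orP[/eqP<-|tp] lc.
    by apply/negP => /and3P[_ /hasPn/(_ _ lc)]; rewrite mem_head.
  by rewrite /= tp.
apply: (unsafe_edge uw); rewrite ?inE ?orbT // => _.
  apply: (unsafe_lollipop (x := u) (p := p1) (c := c1)) => //.
  - by rewrite setU11.
  - move=> t tp; rewrite !inE andbT negb_or (aux u p1 c1) //=; last exact/and5P.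
    by apply: contraNneq nw => <-; rewrite mem_cat tp.
  - move=> t tc tu; rewrite !inE andbT negb_or tu.
    by apply: contraNneq nw => <-; rewrite mem_cat tc orbT.
apply: (unsafe_lollipop (x := w) (p := p2) (c := c2)) => //.
- by rewrite setU11.
- move=> t tp; rewrite !inE andbT negb_or andbC (aux w p2 c2) //=; last exact/and5P.
  by apply: contraNneq nu => <-; rewrite mem_cat tp.
move=> t tc tu; rewrite !inE andbT negb_or andbC tu.
by apply: contraNneq nu => <-; rewrite mem_cat tc orbT.
Qed.

End Lister.

Section ListerCycles.
Variable G : sgraph.
Local Notation adj := (@adj G).
Implicit Types (A D U V X W K : {set G}) (x y z u v w : G) (e : nat).
Implicit Types (p q c : seq G).

(** Here [p], [q], [r] are the inner vertices of the three paths. With [u] and [x]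
the first two vertices of [p], the cycle formed by [q] and [r] is at the end of
a lollipop from [u] through [v], and of one from [x] through the rest of [p]. *)
Lemma unsafe_theta v w p q r :
  path adj v (rcons p w) -> path adj v (rcons q w) -> path adj v (rcons r w) ->
  uniq (v :: w :: p ++ q ++ r) -> 1 < size p -> 1 < size q + size r ->
  ~~ safe (size p + size q + size r) set0 [set: G].
Proof.
case: p => [|u [|x p]] //= /and3P[vu ux xp] vq vr.
rewrite !inE !negb_or !mem_cat !negb_or -!andbA.
case/and5P=> vw vNu vNx vNp /and5P[vNq vNr wNu wNx /and5P[wNp wNq wNr uNx]].
case/and5P=> uNp uNq uNr xNp /and3P[xNq xNr].
rewrite cat_uniq has_cat negb_or cat_uniq => /and3P[unp /andP[pq pr] /and3P[unq qr unr]] _ qr1.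
pose c := v :: q ++ w :: rev r.
have cyc : ucycleb adj c.
  rewrite /ucycleb /c /= rcons_cat cat_path /= -cat_rcons.
  move: vq; rewrite rcons_path => /andP[-> ->]; rewrite path_rev //=.
  rewrite cat_rcons cat_uniq /= !mem_cat !inE mem_rev !negb_or vNq vw vNr unq wNq.
  by rewrite has_rev qr mem_rev wNr rev_uniq unr.
have szc : size c = size q + size r + 2.
  by rewrite /c /= size_cat /= size_rev; clear; lia.
have cE z : (z \in c) = [|| z == v, z == w, z \in q | z \in r].
  by rewrite !inE mem_cat inE mem_rev; congr (_ || _); exact: orbCA.
have [cc uc] := andP cyc.
have sc : 3 < size c by rewrite szc; clear -qr1; lia.
clearbody c.
apply: (@unsafe_two_lollipops _ _ u x [:: v] c (rcons p w) c) => //.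
- rewrite /lollipop /= adj_sym vu cyc sc uc !cE eqxx /= !negb_or.
  by rewrite (eq_sym u v) vNu (eq_sym u w) wNu uNq uNr.
- rewrite /lollipop xp cyc last_rcons cE eqxx orbT belast_rcons sc.
  rewrite cat_uniq /= xNp unp uc !andbT. apply/hasPn => z; rewrite cE inE negb_or.
  case/or4P=> [/eqP->|/eqP->|zq|zr].
  - by rewrite vNx vNp.
  - by rewrite wNx wNp.
  - by rewrite (memPn xNq) // (hasPn pq).
  - by rewrite (memPn xNr) // (hasPn pr).
- by rewrite inE cE !negb_or (eq_sym x v) vNx (eq_sym x w) wNx xNq xNr.
- by rewrite mem_cat mem_rcons inE cE !negb_or uNp (eq_sym u v) vNu (eq_sym u w) wNu uNq uNr.
- by rewrite szc /=; clear; lia.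
by rewrite szc size_rcons /=; clear; lia.
Qed.

(** Lister marks [v] with two neighbors. If Painter colors [v], these neighbors
are the ends of a path through [q]; otherwise [v] has one mark left and lies on
the cycle [v :: c]. The two cases may share vertices, as in [K_{2,4}]. *)
Lemma unsafe_touch e v a q a' c :
  path adj a (rcons q a') -> adj v a -> adj v a' ->
  uniq (v :: a :: rcons q a') ->
  path adj v (rcons c v) -> uniq (v :: c) -> a \notin c -> a' \notin c ->
  2 < size c -> size q + 3 <= e -> size c + 2 <= e ->
  ~~ safe e set0 [set: G].
Proof.
move=> aq va va'; rewrite /= rcons_uniq !inE !mem_rcons !inE !negb_or -!andbA.
case/and5P=> vNa vNa' vNq aNa' /and3P[aNq a'Nq unq].
move=> vc /andP[vNc unc] aNc a'Nc sc le1 le2.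
have cV : #|[set v; a; a']| = 3.
  by rewrite -setUA cardsU1 !inE cards2 aNa' negb_or vNa vNa'.
apply: (@unsafe_step _ _ _ _ [set v; a; a']).
- by rewrite set0U subsetT.
- by rewrite -card_gt0 cV.
- by rewrite cV; clear -le1; lia.
move=> X iX _ _; rewrite cV; have [vX|vX] := boolP (v \in X).
  have X' t : adj v t -> t \notin X.
    by move=> vt; case: (independent_edge iX vt); rewrite ?vX.
  apply: (@unsafe_path_long _ _ _ _ a q a') => //.
  - by rewrite /= mem_rcons inE negb_or aNa' aNq rcons_uniq a'Nq unq.
  - by rewrite !inE X' // eqxx !orbT.
  - by rewrite !inE X' // eqxx !orbT.
  - move=> t tq; rewrite !inE andbT !negb_or -andbA.
    by apply/and3P; split; apply: contraTneq tq => ->.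
  - by clear -le1; lia.
apply: (@unsafe_lollipop_path _ _ _ _ v [::] c) => //=.
- by rewrite vNc unc.
- by rewrite !inE vX eqxx orbT.
- move=> t tq; rewrite !inE andbT !negb_or -andbA.
  by apply/and3P; split; apply: contraTneq tq => ->.
- by clear -le2; lia.
Qed.

Lemma next_inj c : uniq c -> {in c &, injective (next c)}.
Proof. by move=> uc x y xc yc eq; rewrite -(prev_next uc x) eq prev_next. Qed.

(** Otherwise [next c] would exchange the vertices of [c] inside [X] with those
outside, and the size of [c] would be even. *)
Lemma odd_cycle_gap c X : ucycle adj c -> odd (size c) -> independent X ->
  exists2 x, x \in c & (x \notin X) && (next c x \notin X).
Proof.
move=> /andP[cc uc] oc iX; apply/exists_inP; apply: contraLR oc.
rewrite negb_exists_in => /forall_inP H.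
have nX x : x \in c -> (next c x \in X) = (x \notin X).
  move=> xc; apply/idP/idP => [nx|xX].
    apply: contraL (next_cycle cc xc) => xX.
    by move/independentP: iX; apply.
  by have := H x xc; rewrite xX /= negbK.
have le1 : #|[set x in c | x \in X]| <= #|[set x in c | x \notin X]|.
  rewrite -(card_in_imset (f := next c)).
    apply/subset_leq_card/subsetP => y /imsetP[x + ->]; rewrite !inE => /andP[xc xX].
    by rewrite mem_next xc nX ?xX.
  by move=> x y; rewrite !inE => /andP[xc _] /andP[yc _]; apply: next_inj.
have le2 : #|[set x in c | x \notin X]| <= #|[set x in c | x \in X]|.
  rewrite -(card_in_imset (f := next c) (D := mem [set x in c | x \notin X])).
    apply/subset_leq_card/subsetP => y /imsetP[x + ->]; rewrite !inE => /andP[xc xX].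
    by rewrite mem_next xc nX ?xX.
  by move=> x y; rewrite !inE => /andP[xc _] /andP[yc _]; apply: next_inj.
have eqX : #|[set x in c | x \in X]| = #|[set x in c | x \notin X]|.
  by apply/eqP; rewrite eqn_leq le1 le2.
rewrite -(card_uniqP uc) -(cardID (mem X) (mem c)).
have -> : #|[predI mem c & mem X]| = #|[set x in c | x \in X]|.
  by apply: eq_card => x; rewrite !inE.
have -> : #|[predD mem c & mem X]| = #|[set x in c | x \notin X]|.
  by apply: eq_card => x; rewrite !inE andbC.
by rewrite eqX addnn odd_double.
Qed.

(** Marking the whole cycle costs [size c - 1] and leaves two adjacent vertices
with one mark each. *)
Lemma unsafe_odd_cycle c : ucycle adj c -> odd (size c) ->
  ~~ safe (size c) set0 [set: G].
Proof.
move=> uc oc; have cV : #|[set x in c]| = size c.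
  by rewrite cardsE; apply/card_uniqP; case/andP: uc.
apply: (@unsafe_step _ _ _ _ [set x in c]).
- by rewrite set0U subsetT.
- by rewrite -card_gt0 cV; case: (size c) oc.
- by rewrite cV.
move=> X iX _ _; have [x xc /andP[xX nX]] := odd_cycle_gap uc oc iX.
have cxn : adj x (next c x) by apply: next_cycle; case/andP: uc.
apply: (@unsafe_adj _ _ _ _ x (next c x)) => //.
- by rewrite !inE xX xc orbT.
- by rewrite !inE nX mem_next xc orbT.
by rewrite cV subSnn.
Qed.

End ListerCycles.

(** * Winning strategies for Painter *)
Section Painter.
Variable G : sgraph.
Local Notation adj := (@adj G).
Implicit Types (A D S T U V X W K : {set G}) (x y z u v w a b : G) (e : nat).
Implicit Types (p q c : seq G).

Lemma independent1 v : independent [set v].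
Proof.
by apply/independentP => x y; rewrite !inE => /eqP-> /eqP->; rewrite adj_irrefl.
Qed.

Lemma independent_card1 V : #|V| <= 1 -> independent V.
Proof.
move/card_le1P => V1; apply/independentP => x y xV yV.
by move: yV; rewrite (V1 x xV) inE => /eqP->; rewrite adj_irrefl.
Qed.

Lemma safe_independent e A D : independent (A :|: D) -> safe e A D.
Proof.
have [m] := ubnP (weight A D); elim: m e A D => // m IHm e A D wt iU.
apply/safeP => V VU V0 _; exists V.
split=> //; [exact: independentS iU|exact: subsetIl|].
apply: IHm.
  by apply: leq_trans (weight_move VU V0 (subsetIl _ _)) _.
apply: independentS iU; rewrite setDv setU0; apply: setUSS; exact: subsetDl.
Qed.

(** Painter answers on both parts independently; each part receives at most the
marked set, and therefore at most its excess. *)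
Lemma safe_union e A1 D1 A2 D2 :
  {in A1 :|: D1 & A2 :|: D2, forall x y, ~~ adj x y} ->
  safe e A1 D1 -> safe e A2 D2 -> safe e (A1 :|: A2) (D1 :|: D2).
Proof.
have [m] := ubnP (weight A1 D1 + weight A2 D2).
elim: m e A1 D1 A2 D2 => // m IHm e A1 D1 A2 D2 wt noE s1 s2.
apply/safeP => V VU V0 Ve.
have [X1 [iX1 AX1 XV1 s1']] := safe_answer s1 V0 Ve.
have [X2 [iX2 AX2 XV2 s2']] := safe_answer s2 V0 Ve.
have X12 x y : x \in X1 -> y \in X2 -> ~~ adj x y.
  move=> /(subsetP XV1); rewrite inE => /andP[_ xU].
  by move=> /(subsetP XV2); rewrite inE => /andP[_ yU]; apply: noE.
have w1 := weight_answer D1 AX1; have w2 := weight_answer D2 AX2.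
have VU0 : 0 < #|V :&: (A1 :|: D1)| + #|V :&: (A2 :|: D2)|.
  apply: leq_trans (leq_card_setU _ _); rewrite -setIUr card_gt0.
  by rewrite setUACA (setIidPl VU).
exists (X1 :|: X2); split.
- apply/independentP => x y /setUP[]xX /setUP[]yX.
  + by move/independentP: iX1; apply.
  + exact: X12.
  + by rewrite adj_sym X12.
  + by move/independentP: iX2; apply.
- by rewrite setIUr; apply: setUSS.
- rewrite subUset (subset_trans XV1 (subsetIl _ _)).
  exact: subset_trans XV2 (subsetIl _ _).
apply: safe_mono (IHm _ _ _ _ _ _ _ s1' s2') => //.
- apply/subsetP => x; have := subsetP VU x; rewrite !inE !negb_or.
  case: (x \in V); case: (x \in X1); case: (x \in X2) => //=;
  by case: (x \in A1); case: (x \in A2); case: (x \in D1); case: (x \in D2) => // /(_ isT).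
- by rewrite setDUl.
- by clear -wt w1 w2 VU0; lia.
move=> x y xU yU; apply: noE.
  by move: xU; rewrite !inE -orbA => /or3P[/andP[_ ->]|/and3P[]|/andP[_ ->]]; rewrite ?orbT.
by move: yU; rewrite !inE -orbA => /or3P[/andP[_ ->]|/and3P[]|/andP[_ ->]]; rewrite ?orbT.
Qed.

Lemma safe_isolated e A D v :
  {in A :|: D, forall x, ~~ adj v x} -> safe e A D -> safe e (v |: A) D.
Proof.
move=> noE s; rewrite -[D in safe _ _ D](set0U D).
apply: safe_union s; last by apply: safe_independent; rewrite setU0 independent1.
by move=> x y; rewrite setU0 inE => /eqP->; apply: noE.
Qed.

(** Painter ignores [v] until it is marked. If she then colors its neighbor, [v]
becomes isolated with one mark left, which is enough; if not, she can color [v]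
in the same round. *)
Lemma safe_pendant e A D v : v \notin A ->
  {in A :|: D &, forall x y, adj v x -> adj v y -> x = y} ->
  safe e A D -> safe e A (v |: D).
Proof.
have [m] := ubnP (weight A D); elim: m e A D => // m IHm e A D wt vA deg1 s.
apply/safeP => V VU V0 Ve.
have [X [iX AX XV s']] := safe_answer s V0 Ve.
set A' := (_ :|: _) in s'; set D' := D :\: V in s'.
have subU : A' :|: D' \subset A :|: D.
  apply/subsetP => x; rewrite !inE -orbA.
  by case/or3P=> [/andP[_ ->]|/and3P[]|/andP[_ ->]]; rewrite ?orbT.
have XV' : X \subset V by apply: subset_trans XV (subsetIl _ _).
have VX x : x != v -> x \in V -> x \notin X -> x \in A'.
  move=> xv xV xX; move: (subsetP VU x xV); rewrite !inE xV xX (negPf xv).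
  by move=> /= ->.
have newA (Y : {set G}) : X \subset Y -> A :\: V :|: V :\: Y \subset v |: A'.
  move=> /subsetP XY; apply/subsetP => x.
  have [->|xv] := eqVneq x v; first by rewrite setU11.
  rewrite in_setU => /orP[xAV|]; first by rewrite !inE in xAV *; rewrite xAV orbT.
  rewrite !inE => /andP[xY xV]; rewrite (negPf xv) /=.
  by have := VX x xv xV (contra (XY x) xY); rewrite !inE.
have [vV|vV] := boolP (v \in V); last first.
  exists X; split=> //.
  have VU' : V \subset A :|: D.
    apply/subsetP => x xV; have := subsetP VU x xV; rewrite !inE.
    by case: eqVneq xV => [->|//]; rewrite (negPf vV).
  apply: safe_mono (IHm _ A' D' _ _ _ s') => //.
  - apply/subsetP => x xA'; have := subsetP (newA X (subxx _)) x xA'.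
    rewrite in_setU1 => /predU1P[xv|//]; move: xA'.
    by rewrite xv !inE (negPf vA) (negPf vV) !andbF.
  - by apply/subsetP => x; rewrite !inE => /andP[-> /orP[->//|->]]; rewrite orbT.
  - have := weight_answer D AX; rewrite -/A' -/D'.
    have : 0 < #|V :&: (A :|: D)| by rewrite card_gt0 (setIidPl VU').
    by clear -wt; lia.
  - by rewrite !inE (negPf vA) (negPf vV) !andbF.
  - by move=> x y /(subsetP subU) xU /(subsetP subU) yU; apply: deg1.
have DD' : (v |: D) :\: V \subset D'.
  apply/subsetP => x; rewrite !inE => /andP[xV]; rewrite xV /=.
  by case: eqVneq xV => [->|//]; rewrite vV.
have [/exists_inP[u uX vu]|] := boolP [exists u in X, adj v u].
  exists X; split=> //.
  have := subsetP XV u uX; rewrite inE => /andP[uV uU].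
  apply: (safe_mono (leqnn _) (newA X (subxx _)) DD').
  apply: safe_isolated s' => x xU'; apply/negP => vx.
  have xu : x = u by apply: deg1 => //; apply: (subsetP subU).
  by move: xU'; rewrite xu !inE uX uV.
rewrite negb_exists_in => /forall_inP noE; exists (v |: X); split.
- apply/independentP => x y /setU1P[->|xX] /setU1P[->|yX].
  + by rewrite adj_irrefl.
  + exact: noE.
  + by rewrite adj_sym noE.
  + by move/independentP: iX; apply.
- exact: subset_trans AX (subsetUr _ _).
- by rewrite subUset sub1set vV.
apply: safe_mono s' => //; apply/subsetP => x xA'.
have := subsetP (newA _ (subsetUr [set v] X)) x xA'.
rewrite in_setU1 => /predU1P[xv|//]; move: xA'.
by rewrite xv !inE eqxx (negPf vA) vV.
Qed.

Lemma safe_pendants e A D T : [disjoint T & A] ->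
  {in T, forall t, {in A :|: D :|: T &, forall x y, adj t x -> adj t y -> x = y}} ->
  safe e A D -> safe e A (T :|: D).
Proof.
have [m] := ubnP #|T|; elim: m T => // m IHm T.
have [->|] := set_0Vmem T; first by rewrite set0U.
case=> t tT Tm dTA deg1 s; rewrite -(setD1K tT) -setUA.
apply: safe_pendant; first by rewrite (disjointFr dTA tT).
  move=> x y xU yU; apply: (deg1 t) => //.
    by move: xU; rewrite !inE => /or3P[->|/andP[_ ->]|->]; rewrite ?orbT.
  by move: yU; rewrite !inE => /or3P[->|/andP[_ ->]|->]; rewrite ?orbT.
apply: IHm => //.
- by move: Tm; rewrite (cardsD1 t) tT.
- exact: disjointWl (subsetDl _ _) dTA.
move=> z /setD1P[_ zT] x y xU yU; apply: (deg1 z) => //.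
  by apply: subsetP xU; rewrite setUS // subsetDl.
by apply: subsetP yU; rewrite setUS // subsetDl.
Qed.

(** Without budget Lister marks one vertex at a time. *)
Lemma safe_budget0 A D : safe 0 A D.
Proof.
have [m] := ubnP (weight A D); elim: m A D => // m IHm A D wt.
apply/safeP => V VU V0 V1; exists V; split=> //.
- exact: independent_card1.
- exact: subsetIl.
apply: (@safe_mono _ 0 _ (A :\: V) _ (D :\: V)) => //.
- by rewrite leq_subLR addn0 card_gt0.
- by rewrite setDv setU0.
apply: IHm; have := weight_move VU V0 (subsetIl V A).
by rewrite setDv setU0; clear -wt; lia.
Qed.

(** The only way to spend the budget is to mark two vertices, and Painter loses
that move only if both have their last mark and are adjacent. *)
Lemma safe_budget1 A D : independent A -> safe 1 A D.
Proof.
have [m] := ubnP (weight A D); elim: m A D => // m IHm A D wt iA.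
apply/safeP => V VU V0; rewrite leq_eqVlt ltnS => /orP[/eqP V2|V1].
  exists (V :&: A); rewrite V2 subnn; split=> //.
  - by apply: independentS iA; apply: subsetIr.
  - exact: subsetIl.
  - exact: safe_budget0.
exists V; split=> //.
- exact: independent_card1.
- exact: subsetIl.
have wm := weight_move VU V0 (subsetIl V A).
apply: (@safe_mono _ 1 _ _ _ _ _ _ (subxx _) (subxx _)).
  by rewrite leq_subLR addn1 ltnS card_gt0.
rewrite setDv setU0 in wm *; apply: IHm; first by clear -wt wm; lia.
by apply: independentS iA; apply: subsetDl.
Qed.

(** The state of a [K_{2,m}] after Painter colored one of the two centers: [b] has
at most one neighbor with a single mark, so she can treat [b] as pendant to
that one, and all other vertices as pendant to [b]. *)
Lemma safe_star e b S T : ~~ [exists x in S, exists y in S, x != y] ->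
  independent (S :|: T) -> b \notin S :|: T -> [disjoint S & T] ->
  safe e S (b |: T).
Proof.
rewrite negb_exists_in => /forall_inP S1 iST; rewrite inE negb_or => /andP[bS bT] dST.
rewrite setUC; apply: safe_pendants; first by rewrite disjoint_sym.
  move=> t tT x y xU yU tx ty.
  have nbr z : z \in S :|: [set b] :|: T -> adj t z -> z = b.
    rewrite !inE -orbA orbCA => /predU1P[//|zST]; move/independentP: iST => iST.
    by rewrite (negPf (iST t z _ _)) ?inE ?tT ?orbT.
  by rewrite (nbr x xU tx) (nbr y yU ty).
rewrite -(setU0 [set b]); apply: safe_pendant => //; last first.
  by apply: safe_independent; rewrite setU0; apply: independentS iST; apply: subsetUl.
move=> x y; rewrite setU0 => xS yS _ _; apply/eqP; apply: contraT => xy.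
have := S1 x xS; rewrite negb_exists_in => /forall_inP/(_ y yS).
by rewrite xy.
Qed.

(** The path [a], [T], [b] where only [a] has lost a mark: each vertex is pendant
to the part built before it. *)
Lemma safe_K21 e a b T : ~~ adj a b -> independent T ->
  a \notin b |: T -> #|T| <= 1 -> safe e [set a] (b |: T).
Proof.
move=> ab iT; rewrite !inE negb_or => /andP[aNb aT] T1.
apply: safe_pendant; first by rewrite inE eq_sym.
  move=> x y; rewrite !inE => /predU1P[->|xT]; first by rewrite adj_sym (negPf ab).
  case/predU1P=> [->|yT] _; first by rewrite adj_sym (negPf ab).
  by move/card_le1P: T1 => /(_ x xT y); rewrite yT inE => /esym/eqP.
rewrite -[T]setU0; apply: safe_pendants.
- by rewrite disjoint_sym disjoints1.
- move=> t tT x y; rewrite setU0 !inE.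
  have nT z : z \in T -> ~~ adj t z by move=> zT; move/independentP: iT; apply.
  move=> /predU1P[->|/nT/negPf->//] /predU1P[->|/nT/negPf->//] //.
by apply: safe_independent; rewrite setU0 independent1.
Qed.

(** The state of a [K_{2,4}] in which two leaves are colored and one center has
lost a mark. After the only move that matters, one with two marked vertices,
it is enough that the vertices with one mark are independent, by
[safe_budget1]. *)
Lemma safe_K22 a b T A D : ~~ adj a b -> independent T -> a \notin b |: T ->
  A \subset [set a] -> D \subset b |: T -> safe 2 A D.
Proof.
move=> ab iT aNbT.
have [m] := ubnP (weight A D); elim: m A D => // m IHm A D wt Aa DbT.
have iAD X : X \subset [set a; b] -> independent X.
  move=> Xab; apply: independentS Xab _; apply/independentP => x y.
  by move=> /set2P[]-> /set2P[]->; rewrite ?adj_irrefl ?(adj_sym b a) ?ab.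
apply/safeP => V VU V0 V3.
have [V1|V1] := leqP #|V| 1.
  exists V; split=> //; [exact: independent_card1|exact: subsetIl|].
  have wm := weight_move VU V0 (subsetIl V A).
  apply: (@safe_mono _ 2 _ _ _ _ _ _ (subxx _) (subxx _)).
    by rewrite leq_subLR; clear -V0; rewrite -card_gt0 in V0; lia.
  rewrite setDv setU0 in wm *; apply: IHm; first by clear -wt wm; lia.
    exact: subset_trans (subsetDl _ _) Aa.
  exact: subset_trans (subsetDl _ _) DbT.
have [V2|V2] := leqP #|V| 2; last first.
  exists (V :&: A); split=> //; [|exact: subsetIl|].
    by apply: independentS (independent1 a); apply: subset_trans (subsetIr _ _) Aa.
  have -> : 3 - #|V| = 0 by clear -V2; lia.
  exact: safe_budget0.
have cV : #|V| = 2 by apply/eqP; rewrite eqn_leq V1 V2.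
rewrite cV; have aA : A :\: V \subset [set a; b].
  by apply: subset_trans (subsetDl _ _) (subset_trans Aa _); rewrite sub1set set21.
have [iV|niV] := boolP (independent V).
  exists V; split=> //; first exact: subsetIl.
  by apply: safe_budget1; apply: iAD; rewrite setDv setU0.
have [aV|aV] := boolP (a \in V).
  exists [set a]; split; first exact: independent1.
  - exact: subset_trans (subsetIr _ _) Aa.
  - by rewrite sub1set.
  apply: safe_budget1; have -> : A :\: V = set0.
    by apply/eqP; rewrite setD_eq0; apply: subset_trans Aa _; rewrite sub1set.
  rewrite set0U; apply: independent_card1.
  by have := cardsD1 a V; rewrite aV cV; clear; lia.
have AV0 : V :&: A = set0.
  apply/eqP; rewrite setIC setI_eq0; apply: disjointWl Aa _.
  by rewrite disjoints1.
exists (V :\ b); split.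
- apply: independentS iT; apply/subsetP => x /setD1P[xb xV].
  have := subsetP VU x xV; rewrite inE => /orP[/(subsetP Aa)|/(subsetP DbT)].
    by rewrite inE => /eqP xa; rewrite xa (negPf aV) in xV.
  by rewrite !inE (negPf xb).
- by rewrite AV0 sub0set.
- exact: subsetDl.
apply: safe_budget1; apply: iAD; rewrite subUset aA.
by apply/subsetP => x; rewrite !inE negb_and negbK => /andP[/orP[->|/negPf->]]; rewrite ?orbT.
Qed.

(** Painter colors both centers if both are marked, and the marked leaves if no
center is. If just one center is marked, she colors it when at most one leaf
is marked, and the marked leaves otherwise. What
remains is then a set of isolated vertices, a smaller [K_{2,m}], or, with at
most three leaves, one of the trees above. Four leaves may also leave a 4-cycle
with one lost mark, but then Lister has already spent two units of his budget
of 4. *)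
Lemma safe_K2m e a b T : ~~ adj a b -> a != b -> independent T ->
  a \notin T -> b \notin T -> (#|T| <= 3) || ((#|T| <= 4) && (e <= 4)) ->
  safe e set0 (a |: (b |: T)).
Proof.
have [m] := ubnP #|T|; elim: m e T a b => // m IHm e T a b Tm ab aNb iT aT bT szT.
have one x y V : ~~ adj x y -> x != y -> x \notin T -> y \notin T ->
    V \subset x |: (y |: T) -> #|V| <= e.+1 -> x \in V -> y \notin V ->
    exists X, [/\ independent X, V :&: set0 \subset X, X \subset V &
      safe (e.+1 - #|V|) (set0 :\: V :|: V :\: X) ((x |: (y |: T)) :\: V)].
  move=> xy xNy xT yT VU Ve xV yV; set S := V :&: T.
  have VS : V = x |: S.
    apply/setP => z; rewrite !inE; have := subsetP VU z; rewrite !inE.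
    case: eqVneq => [->|_] /=; first by rewrite xV.
    case: eqVneq => [->|_] /=; first by rewrite (negPf yV).
    by case: (z \in V) => // ->.
  have cV : #|V| = #|S|.+1 by rewrite VS cardsU1 !inE (negPf xT) andbF.
  have cS := cardsID V T; rewrite setIC -/S in cS.
  have DV : (x |: (y |: T)) :\: V = y |: (T :\: V).
    apply/setP => z; rewrite !inE; case: eqVneq => [->|_] /=.
      by rewrite xV (negPf xNy).
    by case: eqVneq => [->|_] //=; rewrite yV.
  have ST : S \subset T by apply: subsetIr.
  have iS : independent S by apply: independentS iT.
  have iTV : independent (T :\: V) by apply: independentS iT; apply: subsetDl.
  rewrite setI0 set0D DV; have [S1|S1] := leqP #|S| 1.
    exists [set x]; rewrite sub0set sub1set xV set0U; split=> //; first exact: independent1.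
    have -> : V :\: [set x] = S by rewrite VS setU1K // !inE (negPf xT) andbF.
    apply: safe_star.
    - apply/negP => /exists_inP[z zS /exists_inP[t tS]].
      by move/card_le1P: S1 => /(_ z zS t); rewrite tS inE => /esym/eqP->; rewrite eqxx.
    - by apply: independentS iT; rewrite subUset ST subsetDl.
    - by rewrite !inE (negPf yT) !andbF.
    - by rewrite -setI_eq0 setIDA -setIDAC; apply/eqP/setP => z; rewrite !inE; case: (z \in V).
  exists S; rewrite sub0set subsetIl set0U; split=> //.
  have -> : V :\: S = [set x] by rewrite VS setUC setDUl setDv set0U; apply/setDidPl; rewrite disjoints1 !inE (negPf xT) andbF.
  have xyT : x \notin y |: (T :\: V) by rewrite !inE (negPf xT) negb_or xNy andbF.
  have [TV1|TV1] := leqP #|T :\: V| 1; first exact: safe_K21.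
  apply: (@safe_mono _ 2 _ [set x] _ (y |: (T :\: V))) => //; last exact: (@safe_K22 x y (T :\: V)).
  by move: szT; rewrite cV; clear -S1 TV1 cS; lia.
apply/safeP => V; rewrite set0U => VU V0 Ve.
have [aV|aV] := boolP (a \in V); have [bV|bV] := boolP (b \in V).
- exists [set a; b]; split.
  + apply/independentP => x y /set2P[]-> /set2P[]->;
    by rewrite ?adj_irrefl ?(adj_sym b a) ?ab.
  + by rewrite setI0 sub0set.
  + by rewrite subUset !sub1set aV bV.
  apply: safe_independent; apply: independentS iT; apply/subsetP => x.
  rewrite !inE !negb_or -!andbA andbF /=.
  case/orP=> [/and3P[xa xb xV]|/andP[xV /or3P[/eqP xE|/eqP xE|//]]].
  + by have := subsetP VU x xV; rewrite !inE (negPf xa) (negPf xb).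
  + by rewrite xE aV in xV.
  + by rewrite xE bV in xV.
- exact: one.
- rewrite setUCA in VU *; apply: one => //; by rewrite ?(adj_sym b a) // eq_sym.
have VT : V \subset T.
  apply/subsetP => x xV; have := subsetP VU x xV; rewrite !inE.
  by case/or3P=> [/eqP xE|/eqP xE|//]; rewrite xE ?(negPf aV) ?(negPf bV) in xV.
exists V; rewrite setI0 sub0set; split=> //; first exact: independentS iT.
rewrite setDv set0D setU0.
have -> : (a |: (b |: T)) :\: V = a |: (b |: T :\: V).
  apply/setP => x; rewrite !inE; case: eqVneq => [->|_] /=; first by rewrite aV.
  by case: eqVneq => [->|_] //=; rewrite bV.
have cT := cardsID V T; rewrite (setIidPr VT) in cT.
rewrite -card_gt0 in V0.
apply: IHm => //.
- by clear -Tm cT V0; lia.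
- by apply: independentS iT; apply: subsetDl.
- by rewrite !inE (negPf aT) andbF.
- by rewrite !inE (negPf bT) andbF.
by move: szT; clear -cT V0; lia.
Qed.

End Painter.

Section PainterCycle.
Variable G : sgraph.
Local Notation adj := (@adj G).
Implicit Types (A D S T U V X W K : {set G}) (x y z u v w a b : G) (e : nat).
Implicit Types (p q c : seq G) (s : G -> G).

(** A kernel of the digraph with arcs from [v] to [s v], restricted to [V]. *)
Definition kernel s V X :=
  [/\ independent X, X \subset V & {in V, forall v, v \notin X -> s v \in X}].

(** The hypothesis on sinks expresses that [V] contains no directed cycle. A sink
belongs to the kernel, and its in-neighbors are dominated by it. *)
Lemma kernel_exists s V :
  {in V &, forall x y, adj x y -> y = s x \/ x = s y} ->
  (forall W, W \subset V -> W != set0 -> exists2 x, x \in W & s x \notin W) ->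
  exists X, kernel s V X.
Proof.
have [m] := ubnP #|V|; elim: m V => // m IHm V Vm edge sink.
have [->|V0] := eqVneq V set0.
  exists set0; split=> // [|x]; last by rewrite inE.
  by apply/independentP => x y; rewrite inE.
have [x xV sx] := sink V (subxx V) V0.
pose V' := V :\: [set y | (y == x) || (s y == x)].
have V'V : V' \subset V by apply: subsetDl.
have [||W|X [iX XV kX]] := IHm V'.
- rewrite -ltnS; apply: leq_trans Vm; rewrite ltnS; apply: proper_card; apply/properP; split=> //.
  by exists x; rewrite // !inE eqxx.
- by move=> y z /(subsetP V'V) yV /(subsetP V'V) zV; apply: edge.
- by move=> /subset_trans/(_ V'V); apply: sink.
have nadj y : y \in X -> ~~ adj x y.
  move=> /(subsetP XV); rewrite !inE negb_or -andbA => /and3P[yx syx yV].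
  apply/negP => /(edge x y xV yV)[yE|xE]; first by rewrite -yE yV in sx.
  by rewrite xE eqxx in syx.
exists (x |: X); split.
- apply/independentP => y z /setU1P[->|yX] /setU1P[->|zX].
  + by rewrite adj_irrefl.
  + exact: nadj.
  + by rewrite adj_sym nadj.
  + by move/independentP: iX; apply.
- by rewrite subUset sub1set xV (subset_trans XV V'V).
move=> y yV; rewrite !inE negb_or => /andP[yx yX].
have [//|syx] := eqVneq (s y) x; apply: kX => //.
by rewrite !inE negb_or yx syx.
Qed.

(** Orient the edges along [s]. Painter keeps the invariant that a vertex has more
marks left than uncolored out-neighbors, by coloring a kernel of each marked
set: a marked vertex outside of the kernel loses one mark and also its
out-neighbor. A move that exhausts the budget needs no kernel, because
[safe_budget0] takes over after it. *)
Lemma safe_successor s e A D :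
  {in A :|: D &, forall x y, adj x y -> y = s x \/ x = s y} ->
  {in A, forall v, s v \notin A :|: D} ->
  (forall V, V \subset A :|: D -> #|V| <= e -> exists X, kernel s V X) ->
  safe e A D.
Proof.
have [m] := ubnP (weight A D); elim: m e A D => // m IHm e A D wt edge As ker.
apply/safeP => V VU V0; rewrite leq_eqVlt ltnS => /orP[/eqP Ve|Ve].
  exists (V :&: A); rewrite Ve subnn; split=> //; last exact: safe_budget0.
    apply/independentP => x y /setIP[xV xA] /setIP[yV yA]; apply/negP.
    case/(edge x y (subsetP VU x xV) (subsetP VU y yV)) => E.
      by have := As x xA; rewrite -E inE yA.
    by have := As y yA; rewrite -E inE xA.
  exact: subsetIl.
have [X [iX XV kX]] := ker V VU Ve.
have AX : V :&: A \subset X.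
  apply/subsetP => v /setIP[vV vA]; apply: contraT => vX.
  have := As v vA; rewrite (subsetP VU) // (subsetP XV) //; exact: kX.
exists X; split=> //; set A' := _ :|: _.
have U'U : A' :|: D :\: V \subset A :|: D.
  apply/subsetP => x; rewrite !inE -orbA.
  case/or3P=> [/andP[_ ->//]|/andP[_ xV]|/andP[_ ->]]; last by rewrite orbT.
  by have := subsetP VU x xV; rewrite inE.
apply: IHm.
- by apply: leq_trans (weight_move VU V0 AX) _.
- by move=> x y /(subsetP U'U) xU /(subsetP U'U) yU; apply: edge.
- move=> v /setUP[/setDP[vA _]|/setDP[vV vX]].
    exact: contra (subsetP U'U _) (As v vA).
  by rewrite !inE (kX v vV vX) (subsetP XV _ (kX v vV vX)).
- move=> W /subset_trans/(_ U'U) WU We; apply: ker => //.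
  by apply: leq_trans We _; rewrite leq_subLR; clear -V0; rewrite -card_gt0 in V0; lia.
Qed.

(** [c] is an induced cycle. *)
Definition chordless c :=
  {in c &, forall x y, adj x y -> y = next c x \/ x = next c y}.

(** A nonempty set that is closed under [next c] contains all of [c]. *)
Lemma cycle_sink c W : uniq c -> W != set0 -> W \proper [set x in c] ->
  exists2 x, x \in W & next c x \notin W.
Proof.
move=> uc /set0Pn[x xW] /properP[/subsetP Wc [y]]; rewrite inE => yc yW.
apply/exists_inP; apply: contraR yW; rewrite negb_exists_in => /forall_inP H.
have closed z : z \in W -> next c z \in W by move=> /H; rewrite negbK.
have xc : x \in c by have := Wc x xW; rewrite inE.
have [i p rot_c] := rot_to xc.
have : fpath (next c) x p.
  have := cycle_next uc; rewrite -(rot_cycle i) rot_c /= rcons_path.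
  by case/andP.
have : y \in x :: p by rewrite -rot_c mem_rot.
elim: p x xW {rot_c xc} => [|z p IHp] x xW.
  by rewrite inE => /eqP->.
rewrite inE => /orP[/eqP->//|yp] /= /andP[/eqP zE zp].
by apply: (IHp z) => //; rewrite -zE closed.
Qed.

Lemma odd_index_next c x : uniq c -> ~~ odd (size c) -> x \in c ->
  odd (index (next c x) c) = ~~ odd (index x c).
Proof.
move=> uc oc xc; rewrite next_nth xc.
case: c uc oc xc => [//|y p] uc oc xc; set i := index x (y :: p).
have ip : i <= size p by have := xc; rewrite -index_mem /= ltnS.
have [lt|ge] := ltnP i (size p).
  by rewrite -[nth y p i]/(nth y (y :: p) i.+1) index_uniq.
have -> : i = size p by apply/eqP; rewrite eqn_leq ip.
by rewrite nth_default //= eqxx; move: oc => /=; rewrite negbK => ->.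
Qed.

(** Proper subsets of the cycle have no directed cycle, and the vertices of even
index form a kernel of the whole cycle. *)
Lemma safe_even_cycle e c : ucycle adj c -> chordless c -> ~~ odd (size c) ->
  safe e set0 [set x in c].
Proof.
move=> /andP[cc uc] ch oc; apply: (@safe_successor (next c)).
- by rewrite set0U => x y; rewrite !inE; apply: ch.
- by move=> x; rewrite inE.
move=> V; rewrite set0U => Vc _; have [VE|Vp] := eqVneq V [set x in c].
  exists [set x in c | ~~ odd (index x c)]; rewrite VE; split.
  - apply/independentP => x y; rewrite !inE => /andP[xc ox] /andP[yc oy].
    apply/negP => /(ch x y xc yc)[E|E].
      by move: oy; rewrite E odd_index_next // ox.
    by move: ox; rewrite E odd_index_next // oy.
  - by apply/subsetP => x; rewrite !inE => /andP[].
  move=> x; rewrite !inE => xc; rewrite xc negbK /= => ox.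
  by rewrite mem_next xc odd_index_next // ox.
apply: kernel_exists => [x y|W WV W0].
  by move=> /(subsetP Vc) + /(subsetP Vc); rewrite !inE; apply: ch.
by apply: cycle_sink => //; apply: sub_proper_trans WV _; rewrite properEneq Vp.
Qed.

(** Marking the whole cycle takes the whole budget, so kernels are needed for
proper subsets only. *)
Lemma safe_cycle c : ucycle adj c -> chordless c ->
  safe (size c).-1 set0 [set x in c].
Proof.
move=> /andP[cc uc] ch; case: c => [|x0 c] in cc uc ch *.
  by rewrite safe_budget0.
apply: (@safe_successor (next (x0 :: c))).
- by rewrite set0U => x y; rewrite !in_set; apply: ch.
- by move=> x; rewrite inE.
move=> V; rewrite set0U => Vc Vs; apply: kernel_exists => [x y|W WV W0].
  by move=> /(subsetP Vc) + /(subsetP Vc); rewrite !in_set; apply: ch.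
apply: cycle_sink => //; apply: sub_proper_trans WV _.
rewrite properEcard Vc cardsE (card_uniqP uc) /=; exact: Vs.
Qed.

End PainterCycle.

(** * Ears *)
Section Ears.
Variables (G : sgraph) (n : nat).
Hypothesis Gn : #|G| = n.
Local Notation adj := (@adj G).
Implicit Types (A D S T U V X W K : {set G}) (x y z u v w a b t : G) (e : nat).
Implicit Types (p q c s : seq G).

Lemma uniq_size_card s : uniq s -> size s <= n.
Proof. by move/card_uniqP <-; rewrite -Gn max_card. Qed.

Lemma cycle_split c v w : ucycle adj c -> v \in c -> w \in c -> v != w ->
  exists p q, [/\ path adj v (rcons p w), path adj w (rcons q v),
    perm_eq (v :: w :: p ++ q) c,
    p = [::] -> next c v = w & q = [::] -> next c w = v].
Proof.
move=> /andP[cc uc] vc wc vw; have [i c' rot_c] := rot_to vc.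
have wc' : w \in c'.
  by move: wc; rewrite -(mem_rot i) rot_c inE eq_sym (negPf vw).
have urot : uniq (v :: c') by rewrite -rot_c rot_uniq.
have : cycle adj (v :: c') by rewrite -rot_c rot_cycle.
have := next_rot i uc; rewrite rot_c.
have permc : perm_eq (v :: c') c by rewrite -rot_c perm_rot.
move: urot permc; case/splitPr: wc' => p q urot permc nextE.
rewrite /= rcons_cat cat_path /= => /and3P[vp pw wq].
exists p, q; split=> //.
- by rewrite rcons_path vp.
- by apply: perm_trans permc; rewrite perm_cons -[w :: q]cat1s -cat1s perm_catCA.
- by move=> pE; rewrite -nextE pE /= eqxx.
move=> qE; rewrite -nextE next_nth qE !inE mem_cat mem_head !orbT.
apply: nth_default; rewrite -cat_cons index_cat size_cat /= addn1.
have /negPf -> : w \notin v :: p.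
  move: urot; rewrite -cat_cons cat_uniq => /and3P[_ + _].
  by rewrite /= negb_or => /andP[].
by rewrite /= eqxx addn0.
Qed.

(** A longest path that leaves [K] immediately and stays outside ends at a vertex
with a second neighbor in [U], which must lie on the path or in [K]. *)
Lemma ear U K :
  (exists v x, [/\ v \in K, x \in U :\: K & adj v x]) ->
  {in U, forall x y, exists z, [/\ z \in U, z != y & adj x z]} ->
  exists v x p y, [/\ v \in K, path adj v (x :: p) && uniq (x :: p),
    {subset x :: p <= U :\: K}, adj (last x p) y &
    (y != last v (belast x p)) && ((y \in K) || (y \in x :: p))].
Proof.
move=> [v0 [x0 [v0K x0U v0x0]]] deg2.
suff main k v x p : #|U| - size p <= k -> v \in K -> path adj v (x :: p) ->
    uniq (x :: p) -> {subset x :: p <= U :\: K} ->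
    exists v x p y, [/\ v \in K, path adj v (x :: p) && uniq (x :: p),
      {subset x :: p <= U :\: K}, adj (last x p) y &
      (y != last v (belast x p)) && ((y \in K) || (y \in x :: p))].
  apply: (main #|U| v0 x0 [::]) => //=; first exact: leq_subr.
    by rewrite v0x0.
  by move=> z; rewrite inE => /eqP->.
elim: k p => [|k IHk] p sz vK xp un pU.
  have : size (x :: p) <= #|U|.
    rewrite -(card_uniqP un); apply/subset_leq_card/subsetP => z /pU.
    by rewrite inE => /andP[].
  by rewrite /=; clear -sz; lia.
have lU : last x p \in U by have := pU _ (mem_last x p); rewrite inE => /andP[].
have [y [yU ny ly]] := deg2 _ lU (last v (belast x p)).
have [yKp|] := boolP ((y \in K) || (y \in x :: p)).
  by exists v, x, p, y; rewrite xp un ny.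
rewrite negb_or => /andP[yK yp]; apply: (IHk (rcons p y)) => //.
- by rewrite size_rcons; clear -sz; lia.
- by rewrite -rcons_cons rcons_path xp.
- by rewrite -rcons_cons rcons_uniq yp.
move=> z; rewrite -rcons_cons mem_rcons inE => /orP[/eqP->|/pU//].
by rewrite inE yK.
Qed.

Lemma ear_tail_cycle v x p y : path adj x p -> uniq (x :: p) ->
  adj (last x p) y -> y != last v (belast x p) -> y \in x :: p ->
  exists p1 c, [/\ path adj x p1, ucycle adj c, last x p1 \in c,
    x :: p = belast x p1 ++ c & 2 < size c].
Proof.
move=> + + + + yp; case/splitPl: yp => p1 p2 p1y.
rewrite cat_path last_cat p1y => /andP[xp1 yp2] un ly ny.
have E : x :: p1 ++ p2 = belast x p1 ++ (y :: p2).
  by rewrite -cat_cons lastI p1y cat_rcons.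
exists p1, (y :: p2); split=> //.
- rewrite /ucycle /= rcons_path yp2 ly.
  by move: un; rewrite E cat_uniq => /and3P[].
- by rewrite p1y mem_head.
case: p2 => [|z [|z' p2]] // in yp2 un ly ny E *; first by rewrite /= adj_irrefl in ly.
by move: ny; rewrite cats1 belast_rcons /= p1y eqxx.
Qed.

(** An ear at the cycle [c] that closes on itself gives a cycle joined to [c] by a
path, and one that returns to its starting vertex [v] gives a cycle that touches
[c] in [v]. *)
Lemma unsafe_ear_lollipop c v x p y : ucycle adj c -> 3 < size c -> v \in c ->
  (forall c, ucycle adj c -> ~~ odd (size c)) ->
  path adj v (x :: p) -> uniq (x :: p) -> ~~ has (mem c) (x :: p) ->
  adj (last x p) y -> y != last v (belast x p) -> (y == v) || (y \in x :: p) ->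
  ~~ safe n.-1 set0 [set: G].
Proof.
move=> cyc sc vc bip /andP[vx xp] un dis ly ny yvp.
have [cc uc] := andP cyc.
have szG : size c + (size p).+1 <= n.
  by rewrite -[(size p).+1]/(size (x :: p)) -size_cat uniq_size_card // cat_uniq uc un dis.
have xc : x \notin c by apply: contra dis => xc; rewrite /= xc.
have [yp|yp] := boolP (y \in x :: p).
  have [p1 [c1 [xp1 uc1 lc1 E sc1]]] := ear_tail_cycle xp un ly ny yp.
  have sc1' : 3 < size c1.
    by have := bip c1 uc1; case: (size c1) sc1 => [|[|[|[|]]]].
  have szE : (size p).+1 = size p1 + size c1.
    by rewrite -[(size p).+1]/(size (x :: p)) E size_cat size_belast.
  have vE : v \notin x :: p.
    by apply: contra dis => vE; apply/hasP; exists v.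
  apply: (@unsafe_two_lollipops _ _ v x [::] c p1 c1) => //=.
  - by rewrite /lollipop /ucycleb /= cc uc vc.
  - by move/andP: uc1 => [cc1 uc1]; rewrite /lollipop /ucycleb xp1 lc1 sc1' cc1 uc1 -E un.
  - rewrite mem_cat negb_or; apply/andP; split; apply: contra vE => vp1.
      have : v \in x :: p1 by rewrite inE vp1 orbT.
      rewrite lastI mem_rcons inE E mem_cat => /orP[/eqP->|->//].
      by rewrite lc1 orbT.
    by rewrite E mem_cat vp1 orbT.
  - by clear -szG; lia.
  - by clear -szG szE sc; lia.
move: yvp; rewrite (negPf yp) orbF => /eqP yv.
case/lastP: p => [|q a'] in un dis ly ny szG xp yp *.
  by rewrite yv /= eqxx in ny.
have [i c' rot_c] := rot_to vc.
have szc : size c = (size c').+1 by rewrite -(size_rot i) rot_c.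
have memc' z : z \in c' -> z \in c.
  by move=> zc'; rewrite -(mem_rot i) rot_c inE zc' orbT.
rewrite last_rcons in ly; rewrite size_rcons in szG.
apply: (@unsafe_touch _ _ v x q a' c') => //.
- by rewrite adj_sym -yv.
- by rewrite cons_uniq un andbT -yv.
- by have := cc; rewrite -(rot_cycle i) rot_c.
- by rewrite -rot_c rot_uniq.
- by apply: contra xc; apply: memc'.
- apply: contra dis => a'c'; apply/hasP; exists a'; last exact: memc'.
  by rewrite !inE mem_rcons mem_head orbT.
- by rewrite szc in sc.
- by clear -szG sc; lia.
by move: szG; rewrite szc; move: (size c') (size q) => k1 k2; clear; lia.
Qed.

Lemma unsafe_theta_card v w p q r :
  path adj v (rcons p w) -> path adj v (rcons q w) -> path adj v (rcons r w) ->
  uniq (v :: w :: p ++ q ++ r) -> 1 < size p -> 1 < size q + size r ->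
  ~~ safe n.-1 set0 [set: G].
Proof.
move=> vp vq vr un p1 qr1; have := uniq_size_card un.
rewrite /= !size_cat => szG.
apply: unsafe_mono (unsafe_theta vp vq vr un p1 qr1) => //.
by clear -szG; lia.
Qed.

End Ears.

(** Reduces the disjointness conditions below to linear arithmetic on
multiplicities. *)
Lemma uniq_count_le (T : eqType) (s s' : seq T) :
  uniq s -> (forall x, count_mem x s' <= count_mem x s) -> uniq s'.
Proof.
move=> us le; apply: count_mem_uniq => x; rewrite -has_pred1 has_count.
by have := le x; rewrite (count_uniq_mem x us); case: (count_mem x s') => [|[|k]] //; case: (x \in s).
Qed.

(** * Copies of [K_{2,3}] in graphs without odd cycles *)
Section Bipartite.
Variables (G : sgraph) (n : nat).
Hypothesis Gn : #|G| = n.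
Local Notation adj := (@adj G).
Implicit Types (A D S T U V X W K : {set G}) (x y z u v w a b t : G) (e : nat).
Implicit Types (p q c s : seq G).
Hypothesis bip : forall c, ucycle adj c -> ~~ odd (size c).

Lemma no_triangle x y z : adj x y -> adj y z -> ~~ adj z x.
Proof.
move=> xy yz; apply/negP => zx; have := bip (c := [:: x; y; z]).
rewrite /ucycle /= xy yz zx !inE negb_or (adj_neq xy) (adj_neq yz).
by rewrite eq_sym (adj_neq zx) => /(_ isT).
Qed.

(** A copy of [K_{2,m}] with centers [a] and [b], for [m = size s]. *)
Definition K2_copy a b s :=
  uniq (a :: b :: s) /\ {in s, forall t, adj a t && adj b t}.

Lemma K2_copy_sym a b s : K2_copy a b s -> K2_copy b a s.
Proof.
case=> un ad; split; last by move=> t /ad/andP[-> ->].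
by move: un; rewrite /= !inE !negb_or eq_sym => /and3P[/andP[-> ->] -> ->].
Qed.

Lemma third_vertex s t t' : uniq s -> size s = 3 ->
  exists2 u, u \in s & (u != t) && (u != t').
Proof.
move=> us s3; apply/hasP; apply: contraT => /hasPn H.
have : size s <= size [:: t; t'].
  apply: uniq_leq_size => // u us'; have := H u us'.
  by rewrite negb_and !negbK !inE.
by rewrite s3.
Qed.

Lemma K2_copy_uniq a b s t t' p : K2_copy a b s -> t \in s -> t' \in s -> t != t' ->
  uniq p -> ~~ has (mem (a :: b :: s)) p -> uniq ([:: a; b; t; t'] ++ p).
Proof.
case=> un _ ts t's tt' up dis; rewrite cat_uniq up andbT; apply/andP; split.
  move: un; rewrite /= !inE !negb_or tt' andbT => /and3P[/andP[-> as_] bs _].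
  rewrite !andbT /=; apply/andP; split; apply/andP; split.
  - by apply: contraNneq as_ => ->.
  - by apply: contraNneq as_ => ->.
  - by apply: contraNneq bs => ->.
  - by apply: contraNneq bs => ->.
apply: contra dis => /hasP[x xp xK]; apply/hasP; exists x => //.
move: xK; rewrite !inE => /or4P[->//|->|/eqP->|/eqP->]; rewrite ?orbT //.
  by rewrite ts !orbT.
by rewrite t's !orbT.
Qed.

Lemma K2_copy_uniq3 a b s t1 t2 t3 x : K2_copy a b s ->
  t1 \in s -> t2 \in s -> t3 \in s -> t1 != t2 -> t1 != t3 -> t2 != t3 ->
  x \notin a :: b :: s -> uniq [:: a; b; t1; t2; t3; x].
Proof.
move=> K t1s t2s t3s n12 n13 n23 xK.
have dis : ~~ has (mem (a :: b :: s)) [:: x] by rewrite /= orbF.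
have := K2_copy_uniq (p := [:: x]) K t1s t2s n12 isT dis.
have := K2_copy_uniq (p := [:: x]) K t1s t3s n13 isT dis.
have := K2_copy_uniq (p := [:: x]) K t2s t3s n23 isT dis.
rewrite /= !inE !negb_or !andbT -!andbA.
case/and5P=> h1 h2 h3 h4 /and5P[h5 h6 h7 h8 /andP[h9 h10]].
case/and5P=> k1 k2 k3 k4 /and5P[k5 k6 k7 k8 /andP[k9 k10]].
case/and5P=> m1 m2 m3 m4 /and5P[m5 m6 m7 m8 /andP[m9 m10]].
by do !(apply/andP; split).
Qed.

(** An ear with a single inner vertex gives a [K_{2,4}]; a longer one gives a theta
graph with two leaves of the copy. *)
Lemma K2_copy_ear_ab a b s p : K2_copy a b s -> size s = 3 ->
  path adj a (rcons p b) -> uniq p -> p != [::] ->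
  ~~ has (mem (a :: b :: s)) p -> ~~ safe n.-1 set0 [set: G].
Proof.
move=> K s3 ap up p0 dis; have [un ad] := K; have us : uniq s by case/and3P: un.
have [t1 t1s _] := third_vertex a a us s3.
have [t2 t2s /andP[t21 _]] := third_vertex t1 t1 us s3.
have [t3 t3s /andP[t31 t32]] := third_vertex t1 t2 us s3.
have /andP[at1 bt1] := ad t1 t1s; have /andP[at2 bt2] := ad t2 t2s.
have /andP[at3 bt3] := ad t3 t3s.
case: p => [|x [|x' p]] // in ap up p0 dis *; last first.
  have big := K2_copy_uniq K t2s t1s t21 up dis.
  apply: (@unsafe_theta_card _ _ Gn a b (x :: x' :: p) [:: t1] [:: t2]) => //.
  - by rewrite /= at1 adj_sym bt1.
  - by rewrite /= at2 adj_sym bt2.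
  by apply: (uniq_count_le big) => z; rewrite /= !count_cat /=; clear; lia.
have big : uniq [:: a; b; t1; t2; t3; x].
  by apply: K2_copy_uniq3 K t1s t2s t3s _ _ _ _; rewrite 1?eq_sym //; rewrite /= orbF in dis.
have n6 : 6 <= n by apply: (uniq_size_card Gn big).
have /and3P[ax xb _] : path adj a [:: x; b] by [].
apply: (@unsafe_touch _ _ a t1 [:: b] t2 [:: t3; b; x]) => //.
- by rewrite /= adj_sym bt1 bt2.
- by apply: (uniq_count_le big) => z /=; clear; lia.
- by rewrite /= at3 (adj_sym t3) bt3 (adj_sym b) xb (adj_sym x) ax.
- apply: (uniq_count_le (s' := [:: a; t3; b; x]) big) => z /=; clear; lia.
- suff /andP[] : uniq [:: t1; t3; b; x] by [].
  by apply: (uniq_count_le big) => z /=; clear; lia.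
- suff /andP[] : uniq [:: t2; t3; b; x] by [].
  by apply: (uniq_count_le big) => z /=; clear; lia.
- by clear -n6; move: n6 => /=; lia.
by clear -n6; move: n6 => /=; lia.
Qed.

(** An ear with a single inner vertex would close a triangle with the edge
[a]-[t]. *)
Lemma K2_copy_ear_at a b s t p : K2_copy a b s -> size s = 3 -> t \in s ->
  path adj a (rcons p t) -> uniq p -> p != [::] ->
  ~~ has (mem (a :: b :: s)) p -> ~~ safe n.-1 set0 [set: G].
Proof.
move=> K s3 ts ap up p0 dis; have [un ad] := K; have us : uniq s by case/and3P: un.
have [t' t's /andP[t't _]] := third_vertex t t us s3.
have /andP[at_ bt] := ad t ts; have /andP[at' bt'] := ad t' t's.
case: p => [|x [|x' p]] // in ap up p0 dis *.
  have /and3P[ax xt _] : path adj a [:: x; t] by [].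
  by have := no_triangle ax xt; rewrite adj_sym at_.
have big := K2_copy_uniq K t's ts t't up dis.
apply: (@unsafe_theta_card _ _ Gn a t (x :: x' :: p) [::] [:: t'; b]) => //.
- by rewrite /= at_.
- by rewrite /= at' adj_sym bt' bt.
by apply: (uniq_count_le big) => z; rewrite /= !count_cat /=; clear; lia.
Qed.

(** If the ear has a single inner vertex [x], the third leaf [u] provides a theta
graph with branch vertices [a] and [t], along [u]-[b], along the edge [a]-[t]
and along [t']-[x]. *)
Lemma K2_copy_ear_tt a b s t t' p : K2_copy a b s -> size s = 3 ->
  t \in s -> t' \in s -> t != t' ->
  path adj t (rcons p t') -> uniq p -> p != [::] ->
  ~~ has (mem (a :: b :: s)) p -> ~~ safe n.-1 set0 [set: G].
Proof.
move=> K s3 ts t's tt' tp up p0 dis; have [un ad] := K.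
have us : uniq s by case/and3P: un.
have /andP[at_ bt] := ad t ts; have /andP[at' bt'] := ad t' t's.
have big := K2_copy_uniq K ts t's tt' up dis.
case: p => [|x [|x' p]] // in tp up p0 dis big *; last first.
  apply: (@unsafe_theta_card _ _ Gn t t' (x :: x' :: p) [:: a] [:: b]) => //.
  - by rewrite /= adj_sym at_ at'.
  - by rewrite /= adj_sym bt bt'.
  by apply: (uniq_count_le big) => z; rewrite /= !count_cat /=; clear; lia.
have [u us' /andP[ut ut']] := third_vertex t t' us s3.
have /andP[au bu] := ad u us'.
have /and3P[tx xt' _] : path adj t [:: x; t'] by [].
apply: (@unsafe_theta_card _ _ Gn a t [:: u; b] [::] [:: t'; x]) => //.
- by rewrite /= au adj_sym bu bt.
- by rewrite /= at_.
- by rewrite /= at' adj_sym xt' adj_sym tx.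
have big' : uniq [:: a; b; t'; t; u; x].
  by apply: K2_copy_uniq3 K t's ts us' _ _ _ _; rewrite 1?eq_sym //; rewrite /= orbF in dis.
by apply: (uniq_count_le big') => z /=; clear; lia.
Qed.

Lemma K2_copy_ear a b s v y p : K2_copy a b s -> size s = 3 ->
  v \in a :: b :: s -> y \in a :: b :: s -> y != v ->
  path adj v (rcons p y) -> uniq p -> p != [::] ->
  ~~ has (mem (a :: b :: s)) p -> ~~ safe n.-1 set0 [set: G].
Proof.
move=> K s3 + + yv vp up p0 dis; have K' := K2_copy_sym K.
have dis' : ~~ has (mem (b :: a :: s)) p.
  by apply: contra dis => /hasP[x xp xK]; apply/hasP; exists x; rewrite // !inE orbCA in xK *.
have yp := path_rev vp; have rp0 : rev p != [::] by rewrite -size_eq0 size_rev size_eq0.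
rewrite !inE => /or3P[/eqP vE|/eqP vE|vs] /or3P[/eqP yE|/eqP yE|ys];
  rewrite ?vE ?yE in vp yp yv.
- by rewrite eqxx in yv.
- exact: K2_copy_ear_ab vp up p0 dis.
- exact: K2_copy_ear_at vp up p0 dis.
- exact: K2_copy_ear_ab vp up p0 dis'.
- by rewrite eqxx in yv.
- exact: (K2_copy_ear_at K') vp up p0 dis'.
- by apply: (K2_copy_ear_at K _ _ yp); rewrite ?rev_uniq ?has_rev.
- by apply: (K2_copy_ear_at K' _ _ yp); rewrite ?rev_uniq ?has_rev.
by apply: (K2_copy_ear_tt K _ vs ys _ vp); rewrite // eq_sym.
Qed.

Lemma K2_copy_cycle a b s v : K2_copy a b s -> size s = 3 -> v \in a :: b :: s ->
  exists c, [/\ ucycle adj c, size c = 4, v \in c & {subset c <= a :: b :: s}].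
Proof.
move=> K s3 vK; have [un ad] := K; have us : uniq s by case/and3P: un.
have [t [ts vt]] : exists t, t \in s /\ v \in [:: a; b; t].
  have [t ts _] := third_vertex a a us s3.
  case: (boolP (v \in s)) vK => vs vK; first by exists v; rewrite !inE eqxx !orbT.
  by exists t; rewrite !inE in vK *; rewrite (negPf vs) orbF in vK; case/orP: vK => ->; rewrite ?orbT.
have [t' t's /andP[t't _]] := third_vertex t t us s3.
have /andP[at_ bt] := ad t ts; have /andP[at' bt'] := ad t' t's.
have big : uniq ([:: a; b; t'; t] ++ [::]) by apply: K2_copy_uniq K t's ts t't _ _.
exists [:: a; t; b; t']; split=> //.
- rewrite /ucycle /= at_ (adj_sym t) bt bt' (adj_sym t') at' /=.
  by apply: (uniq_count_le (s' := [:: a; t; b; t']) big) => z /=; clear; lia.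
- by move: vt; rewrite !inE => /or3P[]->; rewrite ?orbT.
by move=> z; rewrite !inE => /or4P[/eqP->|/eqP->|/eqP->|/eqP->]; rewrite ?ts ?t's ?eqxx ?orbT.
Qed.

Lemma K2_copy_safe e a b s : K2_copy a b s -> size s = 3 ->
  safe e set0 [set x in a :: b :: s].
Proof.
move=> [un ad] s3; have -> : [set x in a :: b :: s] = a |: (b |: [set x in s]).
  by apply/setP => x; rewrite !inE.
have [abs] : [/\ a \notin b :: s, b \notin s & uniq s] by case/and3P: un.
move=> bs us; have [t ts _] := third_vertex a a us s3.
move: abs; rewrite inE negb_or => /andP[ab as_].
have /andP[at_ bt] := ad t ts.
apply: safe_K2m => //; rewrite ?inE //.
- by apply: (no_triangle (y := t)); rewrite ?(adj_sym t).
- apply/independentP => x y; rewrite !inE => /ad/andP[ax _] /ad/andP[ay _].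
  by rewrite adj_sym; apply: (no_triangle (y := a)) => //; rewrite adj_sym.
by rewrite cardsE (card_uniqP us) s3.
Qed.

End Bipartite.

(** * Graphs without odd cycles *)
Section Minimal.
Variables (G : sgraph) (n : nat).
Hypothesis Gn : #|G| = n.
Local Notation adj := (@adj G).
Implicit Types (A D S T U V X W K : {set G}) (x y z u v w a b t : G) (e : nat).
Implicit Types (p q c s : seq G).

Section MinimalUnsafe.
Variables (e : nat) (U : {set G}).
Hypothesis minU : minset (fun W => ~~ safe e set0 W) U.

Lemma minimal_unsafe : ~~ safe e set0 U.
Proof. by case/minsetP: minU. Qed.

Lemma minimal_safe W : W \proper U -> safe e set0 W.
Proof.
move=> WU; apply: contraT => uns; case/minsetP: minU => _ /(_ W uns (proper_sub WU)) E.
by rewrite E properxx in WU.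
Qed.

(** A vertex with at most one neighbor in [U] could be removed, by
[safe_pendant]. *)
Lemma minimal_degree :
  {in U, forall x y, exists z, [/\ z \in U, z != y & adj x z]}.
Proof.
move=> x xU y.
have [/existsP[z /and3P[zU zy xz]]|no] :=
  boolP [exists z, [&& z \in U, z != y & adj x z]]; first by exists z.
have nbr z : z \in set0 :|: (U :\ x) -> adj x z -> z = y.
  rewrite set0U => /setD1P[_ zU] xz; apply/eqP; apply: contraNT no => zy.
  by apply/existsP; exists z; rewrite zU zy.
have := minimal_unsafe; rewrite -(setD1K xU) safe_pendant ?inE //.
  by move=> z z' zU z'U /(nbr z zU)-> /(nbr z' z'U)->.
by apply: minimal_safe; rewrite properD1.
Qed.

Lemma minimal_connected K : K \proper U -> K != set0 ->
  exists v x, [/\ v \in K, x \in U :\: K & adj v x].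
Proof.
move=> KU K0.
have [/exists_inP[v vK /exists_inP[x xU vx]]|no] :=
  boolP [exists v in K, exists x in U :\: K, adj v x]; first by exists v, x.
suff: safe e set0 U by move=> safU; have := minimal_unsafe; rewrite safU.
have UE : U = K :|: U :\: K.
  by rewrite setDE setUIr setUCr setIT (setUidPr (proper_sub KU)).
rewrite UE -[set0]setU0; apply: safe_union.
- rewrite !set0U => x y xK yU; apply: contraNN no => xy.
  by apply/exists_inP; exists x => //; apply/exists_inP; exists y.
- exact: minimal_safe.
apply: minimal_safe; rewrite properEneq subsetDl andbT.
apply: contraNneq K0 => E; rewrite -subset0; apply/subsetP => x xK.
by have := subsetP (proper_sub KU) x xK; rewrite -E inE xK.
Qed.

Lemma minimal_ear K : K \proper U -> K != set0 ->
  exists v x p y, [/\ v \in K, path adj v (x :: p) && uniq (x :: p),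
    {subset x :: p <= U :\: K}, adj (last x p) y &
    (y != last v (belast x p)) && ((y \in K) || (y \in x :: p))].
Proof.
by move=> KU K0; apply: ear minimal_degree; apply: minimal_connected.
Qed.

Lemma minimal_cycle : exists c, [/\ ucycle adj c, 2 < size c & {subset c <= U}].
Proof.
have [x0 x0U] : exists x, x \in U.
  apply/set0Pn; apply: contraNneq minimal_unsafe => ->.
  by apply: safe_independent; rewrite setU0; apply/independentP => x y; rewrite inE.
have [||v [x [p [y [/set1P vE /andP[vp un] pU ly /andP[ny yKp]]]]]] := @minimal_ear [set x0].
- apply/properP; split; first by rewrite sub1set.
  by have [z [zU zx _]] := minimal_degree x0U x0; exists z; rewrite // inE.
- by apply/set0Pn; exists x0; rewrite inE.
have pU' z : z \in x :: p -> z \in U by move=> /pU /setDP[].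
have [yp|yp] := boolP (y \in x :: p).
  have /andP[_ xp] := vp.
  have [p1 [c [_ uc _ E sc]]] := ear_tail_cycle xp un ly ny yp.
  by exists c; split=> // z zc; apply: pU'; rewrite E mem_cat zc orbT.
move: yKp; rewrite (negPf yp) orbF inE -vE => /eqP yv.
exists (v :: x :: p); split.
- apply/andP; split; last by rewrite cons_uniq un -yv yp.
  rewrite -[cycle _ _]/(path adj v (rcons (x :: p) v)) rcons_path vp -yv.
  exact: ly.
- by case: p ny {vp un pU ly yp pU'} => //=; rewrite yv eqxx.
by move=> z; rewrite inE => /predU1P[->|/pU'//]; rewrite vE.
Qed.

End MinimalUnsafe.

Hypothesis bip : forall c, ucycle adj c -> ~~ odd (size c).

Lemma disjoint_from_set c p U : {subset p <= U :\: [set z in c]} -> ~~ has (mem c) p.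
Proof.
by move=> pU; apply/hasPn => z /pU; rewrite !inE => /andP[].
Qed.

(** The two paths close up to a cycle of length [size p + size q + 2]. *)
Lemma same_parity v w p q : path adj v (rcons p w) -> path adj w (rcons q v) ->
  uniq (v :: w :: p ++ q) -> odd (size p) = odd (size q).
Proof.
move=> vp wq un; have := bip (c := v :: p ++ w :: q).
rewrite /ucycle /= rcons_cat cat_path /= size_cat /= addnS /= negbK oddD.
move: vp; rewrite rcons_path => /andP[-> ->]; rewrite wq /=.
have -> : (v \notin p ++ w :: q) && uniq (p ++ w :: q).
  by apply: (uniq_count_le (s' := v :: p ++ w :: q) un) => z /=; rewrite !count_cat /=; clear; lia.
by move=> /(_ isT); case: (odd (size p)); case: (odd (size q)).
Qed.

(** A chord ([p] empty) or an ear of [c] forms a theta graph with the two arcs of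
[c]. All three inner sizes have the same parity, so [unsafe_theta] applies
unless they are all 1, which is the case of [K_{2,3}]. *)
Lemma safe_cycle_ear c v y p : safe n.-1 set0 [set: G] ->
  ucycle adj c -> 3 < size c -> v \in c -> y \in c ->
  y != v -> path adj v (rcons p y) -> uniq p -> ~~ has (mem c) p ->
  (p = [::] -> y != next c v /\ v != next c y) ->
  exists t1 t2 x, [/\ p = [:: x], K2_copy v y [:: t1; t2; x] &
                      c =i [:: v; y; t1; t2]].
Proof.
move=> saf uc sc vc yc yv vp up dis chord.
have vy : v != y by rewrite eq_sym.
have [q [r [vq yr perm nq nr]]] := cycle_split uc vc yc vy.
have szc : size q + size r + 2 = size c.
  by rewrite -(perm_size perm) /= size_cat addn2.
have un : uniq (v :: y :: q ++ r ++ p).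
  have -> : v :: y :: q ++ r ++ p = (v :: y :: q ++ r) ++ p by rewrite /= catA.
  rewrite cat_uniq up (perm_uniq perm); case/andP: uc => _ ->; rewrite andbT /=.
  by apply: contra dis => /hasP[z zp zc]; apply/hasP; exists z => //; exact: etrans (esym (perm_mem perm z)) zc.
have vr := path_rev yr; have yp := path_rev vp.
have un3 l : (forall z, count_mem z l <= count_mem z (v :: y :: q ++ r ++ p)) -> uniq l.
  exact: uniq_count_le.
have odd_qr : odd (size q) = odd (size r).
  apply: same_parity vq yr _; apply: un3 => z /=; rewrite !count_cat; clear; lia.
have odd_qp : odd (size q) = odd (size p).
  rewrite -(size_rev p); apply: same_parity vq yp _.
  by apply: un3 => z /=; rewrite !count_cat count_rev; clear; lia.
have absurd : ~~ safe n.-1 set0 [set: G] -> False by rewrite saf.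
have theta1 : 1 < size p -> False.
  move=> p1; apply: absurd; apply: (unsafe_theta_card Gn vp vq vr) => //.
    by apply: un3 => z /=; rewrite !count_cat count_rev; clear; lia.
  by rewrite size_rev; clear -szc sc; lia.
have theta2 : 1 < size q -> 1 < size p + size r -> False.
  move=> q1 pr1; apply: absurd.
  apply: (unsafe_theta_card Gn vq vp vr) => //; last by rewrite size_rev.
  by apply: un3 => z /=; rewrite !count_cat count_rev; clear; lia.
have theta3 : 1 < size r -> 1 < size p + size q -> False.
  move=> r1 pq1; apply: absurd.
  apply: (unsafe_theta_card Gn vr vp vq) => //; last by rewrite size_rev.
  by apply: un3 => z /=; rewrite !count_cat count_rev; clear; lia.
case: p => [|x [|x' p]] in vp yp up dis chord odd_qp theta1 theta2 theta3 un un3 *; last by case: theta1.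
  have [c1 c2] := chord erefl; exfalso.
  have q0 : q <> [::] by move=> /nq E; rewrite E eqxx in c1.
  have r0 : r <> [::] by move=> /nr E; rewrite E eqxx in c2.
  have ge2 l : odd (size l) = false -> l <> [::] -> 1 < size l by case: l => [|? [|]].
  apply: theta2; first exact: ge2.
  by apply: ge2 => //; rewrite -odd_qr.
have odd_q : odd (size q) by rewrite odd_qp.
have odd_r : odd (size r) by rewrite -odd_qr.
have one l : odd (size l) -> (1 < size l -> False) -> exists t, l = [:: t].
  by case: l => [|t [|t' l]] // _ _; exists t.
have [|t1 qE] := one q odd_q.
  by move=> q1; apply: theta2; rewrite // add1n ltnS; case: (r) odd_r.
have [|t2 rE] := one r odd_r.
  by move=> r1; apply: theta3; rewrite // add1n ltnS; case: (q) odd_q.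
subst q r.
exists t1, t2, x; split=> //; last by move=> z; rewrite -(perm_mem perm).
split; first exact: un.
have /and3P[vt1 t1y _] : path adj v [:: t1; y] by [].
have /and3P[yt2 t2v _] : path adj y [:: t2; v] by [].
have /and3P[vx xy _] : path adj v [:: x; y] by [].
move=> z; rewrite !inE => /or3P[] /eqP->.
- by rewrite vt1 adj_sym.
- by rewrite yt2 adj_sym t2v.
by rewrite vx adj_sym.
Qed.

(** If a smallest losing [U] contained more than a cycle it would contain
[K_{2,3}], and if it contained more than [K_{2,3}] Lister would win with budget
[n - 1]. *)
Lemma bipartite_safe e : safe n.-1 set0 [set: G] -> safe e set0 [set: G].
Proof.
move=> saf; apply: contraT => uns.
(* Vertex sets stand for the subgraphs that they induce. *)
have [U minU _] := minset_exists (P := fun W => ~~ safe e set0 W) uns.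
have unsU := minimal_unsafe minU.
have [c [uc sc cU]] := minimal_cycle minU.
have sc4 : 3 < size c.
  by have := bip uc; case: (size c) sc => [|[|[|[|]]]].
have cU' : [set x in c] \subset U by apply/subsetP => x; rewrite inE; apply: cU.
have [UE|UNc] := eqVneq U [set x in c].
  have [/forall_inP ch|] := boolP [forall x in c, forall y in c,
      adj x y ==> ((y == next c x) || (x == next c y))].
    rewrite UE safe_even_cycle ?bip // in unsU => x y xc yc xy.
    have /forall_inP/(_ y yc)/implyP/(_ xy) := ch x xc.
    by case/orP=> /eqP; [left|right].
  rewrite negb_forall_in => /exists_inP[v vc].
  rewrite negb_forall_in => /exists_inP[y yc].
  rewrite negb_imply negb_or => /and3P[vy yn vn].
  have yv : y != v by rewrite eq_sym adj_neq.
  have [||||t1 [t2 [x []]]] // := @safe_cycle_ear c v y [::] saf uc sc4 vc yc yv.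
    by rewrite /= vy.
have c_nonempty (l : seq G) : size l > 0 -> [set x in l] != set0.
  by case: l => // x l _; apply/set0Pn; exists x; rewrite !inE eqxx.
have cprop : [set x in c] \proper U by rewrite properEneq eq_sym UNc.
have [|v [x [p [y [vc /andP[vp un] pU ly /andP[ny yKp]]]]]] := minimal_ear minU cprop.
  by apply: c_nonempty; apply: leq_trans sc4.
rewrite inE in vc; have dis := disjoint_from_set pU.
have [yvp|] := boolP ((y == v) || (y \in x :: p)).
  by have := unsafe_ear_lollipop Gn uc sc4 vc bip vp un dis ly ny yvp; rewrite saf.
rewrite negb_or => /andP[yv yp]; move: yKp; rewrite (negPf yp) orbF inE => yc.
have vpy : path adj v (rcons (x :: p) y) by rewrite rcons_path vp.
have [//|t1 [t2 [x' [[xx' p0] K cE]]]] := safe_cycle_ear saf uc sc4 vc yc yv vpy un dis.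
(* The ear has a single inner vertex [x] and completes the cycle to [K_{2,3}]. *)
subst x' p; set a := v in K cE; set b := y in K cE; set s := [:: t1; t2; x] in K.
have sU : {subset a :: b :: s <= U}.
  move=> z; rewrite !inE => zK; have [->|zx] := eqVneq z x.
    by have /setDP[] := pU x (mem_head _ _).
  by apply: cU; rewrite cE !inE; move: zK; rewrite (negPf zx) orbF.
have Kprop : [set z in a :: b :: s] \proper U.
  rewrite properEneq; apply/andP; split; last by apply/subsetP => z; rewrite inE; apply: sU.
  by apply: contraNneq unsU => <-; apply: K2_copy_safe.
have [|v' [x' [p [y' [v'K /andP[vp' un'] pU' ly' /andP[ny' yKp']]]]]] := minimal_ear minU Kprop.
  exact: c_nonempty.
rewrite inE in v'K; have dis' := disjoint_from_set pU'.
have [yvp|] := boolP ((y' == v') || (y' \in x' :: p)).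
  have [c' [uc' sc' vc' c'K]] := K2_copy_cycle K erefl v'K.
  have disc : ~~ has (mem c') (x' :: p).
    by apply: contra dis' => /hasP[z zp zc]; apply/hasP; exists z => //; apply: c'K.
  have := unsafe_ear_lollipop Gn uc' _ vc' bip vp' un' disc ly' ny' yvp.
  by rewrite sc' saf => /(_ isT).
rewrite negb_or => /andP[yv' yp']; move: yKp'; rewrite (negPf yp') orbF inE => yK.
have vpy' : path adj v' (rcons (x' :: p) y') by rewrite rcons_path vp'.
by have := K2_copy_ear Gn bip K erefl v'K yK yv' vpy' un' isT dis'; rewrite saf.
Qed.

End Minimal.

(** * Odd cycles *)
Lemma next_nth_mod (T : eqType) (c : seq T) (x0 : T) i : uniq c -> i < size c ->
  next c (nth x0 c i) = nth x0 c (i.+1 %% size c).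
Proof.
move=> uc ic; rewrite next_nth mem_nth //; case: c => [//|y p] in uc ic *.
rewrite index_uniq //; have [lt|ge] := ltnP i (size p).
  rewrite modn_small // -[RHS]/(nth x0 p i); exact: set_nth_default.
have -> : i = size p by apply/eqP; rewrite eqn_leq ge andbT.
by rewrite nth_default // modnn.
Qed.

Lemma nth_closed_walk l k : 0 < l -> k <= l -> nth 0 (closed_walk 0 l) k = k %% l.
Proof.
move=> l0 kl; rewrite /closed_walk nth_rcons size_iota.
have [lt|ge] := ltnP k l; first by rewrite nth_iota // modn_small.
have -> : k = l by apply/eqP; rewrite eqn_leq kl.
by rewrite eqxx modnn.
Qed.

(** Position [l] of the closed walk repeats vertex 0, which is [l %% l]. *)
Lemma infix_closed_walk l i j : i < l -> j < l ->
  infix [:: i; j] (closed_walk 0 l) = (j == i.+1 %% l).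
Proof.
move=> il jl; have l0 : 0 < l by apply: leq_ltn_trans il.
have szw : size (closed_walk 0 l) = l.+1 by rewrite size_rcons size_iota.
apply/infixP/eqP => [[s [s' E]]|jE].
  have sl : size s < l by move: szw; rewrite E !size_cat /=; clear; lia.
  have iE : i = size s.
    have := nth_closed_walk l0 (ltnW sl); rewrite E nth_cat ltnn subnn /= => ->.
    by rewrite modn_small.
  have := nth_closed_walk l0 sl.
  by rewrite E nth_cat ltnNge leqnSn subSnn /= iE.
exists (take i (closed_walk 0 l)), (drop i.+2 (closed_walk 0 l)).
rewrite -[LHS](cat_take_drop i); congr (_ ++ _).
rewrite (drop_nth 0) ?szw ?(leqW il) // (drop_nth 0) ?szw //.
by rewrite (nth_closed_walk l0 (ltnW il)) (nth_closed_walk l0 il) jE modn_small.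
Qed.

Lemma adj_cycle_graph l (i j : cycle_graph l) : 2 < l ->
  adj i j = (j == i.+1 %% l :> nat) || (i == j.+1 %% l :> nat).
Proof.
move=> l3; rewrite /= /walk_adj /= orbF /consecutive !infix_closed_walk //.
case: eqVneq => //= ->; rewrite orbb; apply/esym/eqP => E.
have jl := ltn_ord j; have [lt|ge] := ltnP j.+1 l.
  by rewrite modn_small // in E; clear -E; lia.
have jE : j.+1 = l by apply/eqP; rewrite eqn_leq ge andbT.
by rewrite jE modnn in E; clear -E jE l3; lia.
Qed.

Section OddCycle.
Variables (G : sgraph) (n : nat).
Hypothesis Gn : #|G| = n.
Local Notation adj := (@adj G).
Implicit Types (c : seq G).

(** By [unsafe_odd_cycle] all odd cycles are Hamilton cycles. A chord splits [c]
into two shorter cycles, one of which is odd, so [c] is the whole graph. *)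
Lemma safe_is_odd_cycle c : safe n.-1 set0 [set: G] -> ucycle adj c ->
  odd (size c) -> is_odd_cycle G.
Proof.
move=> saf uc oc.
have full c' : ucycle adj c' -> odd (size c') -> size c' = n.
  move=> uc' oc'; apply/eqP; rewrite eqn_leq; apply/andP; split.
    by apply: (uniq_size_card Gn); case/andP: uc'.
  rewrite leqNgt; apply: contraTN saf => lt.
  by apply: unsafe_mono (unsafe_odd_cycle uc' oc') => //; clear -lt; lia.
have szc := full c uc oc; have [cc unc] := andP uc.
have n3 : 2 < n.
  rewrite -szc; case: c cc oc {uc szc unc} => [|x [|y [|z c]]] //=.
  by rewrite adj_irrefl.
have memc x : x \in c.
  have : c =i G; last by move=> ->.
  by apply/subset_cardP; [rewrite (card_uniqP unc) szc | apply/subsetP].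
have ch : chordless c.
  move=> x y _ _ xy; suff: (y == next c x) || (x == next c y).
    by case/orP=> /eqP; [left|right].
  apply: contraT; rewrite negb_or => /andP[ny nx].
  have [p [q [xp yq perm pE qE]]] := cycle_split uc (memc x) (memc y) (adj_neq xy).
  have un : uniq (x :: y :: p ++ q) by rewrite (perm_uniq perm).
  have szpq : size p + size q + 2 = n.
    by rewrite -szc -(perm_size perm) /= size_cat addn2.
  have p0 : 0 < size p by case: (p) pE => // /(_ erefl) E; rewrite E eqxx in ny.
  have q0 : 0 < size q by case: (q) qE => // /(_ erefl) E; rewrite E eqxx in nx.
  have short v w r : path adj v (rcons r w) -> uniq (v :: w :: r) -> adj v w ->
      odd (size r) -> (size r).+2 = n.
    move=> vr unr vw oddr; rewrite -(size_rcons r w); apply: (full (v :: rcons r w)).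
    - rewrite /ucycle [cycle _ _]/= rcons_path vr last_rcons adj_sym vw /=.
      by apply: (uniq_count_le (s' := v :: rcons r w) unr) => z;
        rewrite /= -cats1 count_cat /=; clear; lia.
    by rewrite /= size_rcons /= negbK.
  (* The inner sizes of the two arcs add up to [n - 2], so one of them is odd. *)
  have := oc; rewrite szc -szpq addn2 /= negbK oddD.
  have [oddp _|_] := boolP (odd (size p)).
    have := short x y p xp _ xy oddp; rewrite -szpq.
    have -> : uniq (x :: y :: p).
      by apply: (uniq_count_le un) => z; rewrite /= count_cat; clear; lia.
    by move=> /(_ isT); clear -q0; lia.
  rewrite addFb => oddq; have := short y x q yq _ _ oddq; rewrite -szpq adj_sym xy.
  have -> : uniq (y :: x :: q).
    by apply: (uniq_count_le un) => z; rewrite /= count_cat; clear; lia.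
  by move=> /(_ isT isT); clear -p0; lia.
have x0 : G by case: (c) szc => [E|//]; rewrite -E in n3.
have hx x : index x c < n by rewrite -szc index_mem.
have nextE x : index (next c x) c = (index x c).+1 %% n.
  rewrite -{1}(nth_index x0 (memc x)) next_nth_mod ?index_mem // szc.
  by rewrite index_uniq // szc ltn_mod; clear -n3; lia.
exists n; split=> //; first by rewrite -szc.
exists (fun x => Ordinal (hx x) : cycle_graph n).
  exists (fun i : cycle_graph n => nth x0 c i) => [x|i].
    exact: nth_index.
  by apply: val_inj => /=; rewrite index_uniq // szc.
move=> x y; rewrite adj_cycle_graph //= -!nextE.
have eqc u v : (index u c == index v c) = (u == v).
  by apply/eqP/eqP => [|->//]; apply: index_inj.
rewrite !eqc; apply/orP/idP => [[]/eqP->|/ch[]// ->]; rewrite ?eqxx; try by [left|right].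
  exact: next_cycle.
by rewrite adj_sym; apply: next_cycle.
Qed.

Lemma odd_cycle_safe : is_odd_cycle G -> 2 < n /\ safe n.-1 set0 [set: G].
Proof.
case=> l [l3 lo [h [g hK gK] hmono]].
have nl : n = l by rewrite -Gn (bij_eq_card (Bijective hK gK)) card_ord.
have l0 : 0 < l by apply: leq_trans l3.
pose i0 : cycle_graph l := Ordinal l0; pose c := map g (enum 'I_l).
have szc : size c = l by rewrite size_map size_enum_ord.
have unc : uniq c by rewrite map_inj_uniq ?enum_uniq //; apply: can_inj gK.
have nthc (i : 'I_l) : nth (g i0) c i = g i.
  by rewrite (nth_map i0) ?size_enum_ord // nth_ord_enum.
have memc x : x \in c by rewrite -[x]hK map_f // mem_enum.
have hnext x : h (next c x) = (h x).+1 %% l :> nat.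
  rewrite -{1}[x]hK -nthc next_nth_mod ?szc //.
  pose j : 'I_l := Ordinal (ltn_pmod (h x).+1 l0).
  by rewrite -[_ %% l]/(val j) nthc gK.
have adjE x y : adj x y = (y == next c x) || (x == next c y).
  rewrite -hmono adj_cycle_graph // -!hnext.
  have eqh u v : (h u == h v :> nat) = (u == v).
    by rewrite -(inj_eq (can_inj hK)).
  by rewrite !eqh.
split; first by rewrite nl.
have cc : ucycle adj c.
  apply/andP; split=> //; apply: (sub_cycle (e := frel (next c))); last exact: cycle_next.
  by move=> x y /= /eqP<-; rewrite adjE eqxx.
have -> : [set: G] = [set x in c] by apply/setP => x; rewrite !inE memc.
rewrite nl -szc; apply: safe_cycle => // x y _ _; rewrite adjE.
by case/orP=> /eqP; [left|right].
Qed.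

End OddCycle.

(** * The graphs given by walks *)

(** The adjacency of [walk_graph], extended to all natural numbers so that walks
can be used without bounds. *)
Definition nat_adj (ws : seq (seq nat)) : rel nat :=
  fun i j => (i != j) && has (fun w => consecutive w i j) ws.

Lemma walk_path ws s x p s' : s ++ (x :: p) ++ s' \in ws ->
  path (fun i j => i != j) x p -> path (nat_adj ws) x p.
Proof.
elim: p s x => //= y p IHp s x w_ws /andP[xy yp]; apply/andP; split.
  rewrite /nat_adj xy; apply/hasP; exists (s ++ [:: x, y & p] ++ s') => //.
  by apply/orP; left; apply/infixP; exists s, (p ++ s').
by apply: (IHp (rcons s x)); rewrite ?cat_rcons.
Qed.

Section WalkEmbedding.
Variables (G : sgraph) (N : nat) (ws : seq (seq nat)).
Local Notation adj := (@adj G).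

(** The map [phi] is the inverse of the isomorphism, with an arbitrary value
outside of the vertex range. *)
Lemma walk_embedding : graph_iso G (walk_graph N ws) -> 0 < N ->
  #|G| = N /\ exists phi : nat -> G,
    {in gtn N &, injective phi} /\
    {in gtn N &, {mono phi : i j / nat_adj ws i j >-> adj i j}}.
Proof.
move=> [h [g hK gK] hmono] N0.
split; first by rewrite (bij_eq_card (Bijective hK gK)) card_ord.
exists (fun k => g (insubd (Ordinal N0 : 'I_N) k)); split=> i j iN jN.
  move=> /(can_inj gK)/(congr1 val); rewrite !val_insubd.
  by rewrite -!topredE /= in iN jN; rewrite iN jN.
rewrite -hmono !gK /= /walk_adj /nat_adj -(inj_eq val_inj) !val_insubd.
by rewrite -!topredE /= in iN jN; rewrite iN jN.
Qed.

Lemma embedding_path (phi : nat -> G) x p :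
  {in gtn N &, {mono phi : i j / nat_adj ws i j >-> adj i j}} ->
  all (gtn N) (x :: p) ->
  path adj (phi x) (map phi p) = path (nat_adj ws) x p.
Proof.
move=> mono; rewrite path_map; elim: p x => //= y p IHp x /and3P[xN yN pN].
by rewrite IHp /= ?yN ?pN // mono.
Qed.

Lemma embedding_uniq (phi : nat -> G) p :
  {in gtn N &, injective phi} -> all (gtn N) p -> uniq (map phi p) = uniq p.
Proof.
move=> inj /allP pN; rewrite map_inj_in_uniq // => i j ip jp.
by apply: inj; apply: pN.
Qed.

Lemma embedding_mem (phi : nat -> G) i p : {in gtn N &, injective phi} ->
  i < N -> all (gtn N) p -> (phi i \in map phi p) = (i \in p).
Proof.
move=> inj iN /allP pN; apply/mapP/idP => [[j jp /inj->//]|ip]; last by exists i.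
exact: pN.
Qed.

End WalkEmbedding.

Section Shapes.
Variable G : sgraph.
Local Notation adj := (@adj G).

Lemma all_iota N m l : m + l <= N -> all (gtn N) (iota m l).
Proof. by move=> le; apply/allP => i; rewrite mem_iota /=; lia. Qed.

Lemma last_iota m l : last m (iota m.+1 l) = m + l.
Proof. by elim: l m => [|l IHl] m /=; rewrite ?addn0 // IHl addSnnS. Qed.

Lemma belast_iota m l : belast m (iota m.+1 l) = iota m l.
Proof. by elim: l m => //= l IHl m; rewrite IHl. Qed.

Lemma path_neq (T : eqType) (x : T) p : uniq (x :: p) -> path (fun i j => i != j) x p.
Proof.
elim: p x => //= y p IHp x /andP[+ unp]; rewrite inE negb_or => /andP[-> _].
exact: IHp.
Qed.

Lemma unsafe_theta_graph p q r : 3 <= p -> 1 <= q -> 1 <= r -> 4 <= q + r ->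
  graph_iso G (theta_graph p q r) ->
  ~~ safe (#|G| - 2) set0 [set: G].
Proof.
move=> p3 q1 r1 qr4 iso; have N0 : 0 < p + q + r - 1 by lia.
have [GN [phi [inj mono]]] := walk_embedding iso N0.
set ws := [:: _; _; _] in mono; set N := p + q + r - 1 in inj mono GN.
have walk m l : m + l <= N -> 1 < m -> 0 :: rcons (iota m l) 1 \in ws ->
    path adj (phi 0) (rcons (map phi (iota m l)) (phi 1)).
  move=> mlN m1 w_ws; rewrite -map_rcons (embedding_path mono); last first.
    by rewrite /= all_rcons all_iota //= andbT; move: mlN; rewrite /N; clear -p3; lia.
  apply: (walk_path (s := [::]) (s' := [::])); first by rewrite cats0.
  apply: path_neq; rewrite cons_uniq mem_rcons inE mem_iota rcons_uniq mem_iota iota_uniq.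
  by clear -m1; lia.
have E : 0 :: 1 :: iota 2 (p - 1) ++ iota (p + 1) (q - 1) ++ iota (p + q) (r - 1) = iota 0 N.
  have -> : p + 1 = 2 + (p - 1) by clear -p3; lia.
  have -> : p + q = 2 + (p - 1) + (q - 1) by clear -p3 q1; lia.
  rewrite -iotaD -(iotaD 2) -[iota 2 _]/(iota (0 + 2) _) -[0 :: 1 :: _]/(iota 0 2 ++ _) -iotaD.
  by congr (iota 0 _); rewrite /N; clear -p3 q1 r1; lia.
have un : uniq [:: phi 0, phi 1 & map phi (iota 2 (p - 1)) ++
    map phi (iota (p + 1) (q - 1)) ++ map phi (iota (p + q) (r - 1))].
  rewrite -!map_cat -!map_cons E (embedding_uniq inj) ?iota_uniq //; exact: all_iota.
rewrite GN; apply: unsafe_mono (unsafe_theta (walk 2 (p - 1) _ _ _)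
   (walk (p + 1) (q - 1) _ _ _) (walk (p + q) (r - 1) _ _ _) un _ _) => //;
  rewrite ?size_map ?size_iota ?inE ?eqxx ?orbT // /N;
  by clear -p3 q1 r1 qr4; lia.
Qed.

(** For [k = 1] the cycles touch. For larger [k], the first edge of the path
connects a vertex of the first cycle to the tip of a lollipop whose stick is the
rest of the path. *)
Lemma unsafe_cycle_path_cycle r k s : 4 <= r -> 4 <= s -> 1 <= k ->
  graph_iso G (cycle_path_cycle r k s) ->
  ~~ safe (#|G| - 2) set0 [set: G].
Proof.
move=> r4 s4 k1 iso; have N0 : 0 < r + k + s - 2 by lia.
have [GN [phi [inj mono]]] := walk_embedding iso N0; clear iso.
set ws := [:: _; _; _] in mono; set N := r + k + s - 2 in inj mono GN.
have sub s1 x p s2 : s1 ++ (x :: p) ++ s2 \in ws -> all (gtn N) (x :: p) ->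
    path (fun i j => i != j) x p -> path adj (phi x) (map phi p).
  move=> w_ws pN xp; rewrite (embedding_path mono) //; exact: walk_path w_ws xp.
have iota_path m l s1 s2 : s1 ++ iota m l.+1 ++ s2 \in ws -> m + l < N ->
    path adj (phi m) (map phi (iota m.+1 l)).
  move=> w_ws mlN; apply: (sub s1 m _ s2) => //.
    by rewrite -[_ :: _]/(iota m l.+1) all_iota // addnS.
  by apply: path_neq; rewrite -[_ :: _]/(iota m l.+1) iota_uniq.
have closed m l : 1 < l -> m + l <= N -> closed_walk m l \in ws ->
    path adj (phi m) (rcons (map phi (iota m.+1 l.-1)) (phi m)).
  move=> l1 mlN; have l0 : 0 < l by apply: ltnW.
  have -> : closed_walk m l = m :: rcons (iota m.+1 l.-1) m by case: (l) l0.
  move=> w_ws; rewrite -map_rcons; apply: (sub [::] m _ [::]).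
  - by rewrite cats0.
  - by rewrite /= all_rcons all_iota /=; clear -mlN l1; lia.
  rewrite rcons_path path_neq; last by rewrite -[_ :: _]/(iota m l.-1.+1) iota_uniq.
  by rewrite last_iota; clear -l1; lia.
have cycle m l : 1 < l -> m + l <= N -> closed_walk m l \in ws ->
    ucycle adj (map phi (iota m l)).
  move=> l1 mlN w_ws; apply/andP; split.
    by have := closed m l l1 mlN w_ws; case: (l) l1.
  by rewrite (embedding_uniq inj) ?iota_uniq //; apply: all_iota.
have ws1 : closed_walk 0 r \in ws by rewrite inE eqxx.
have ws2 : iota (r - 1) k \in ws by rewrite !inE eqxx orbT.
have ws3 : closed_walk (r + k - 2) s \in ws by rewrite !inE eqxx !orbT.
clearbody ws.
have rN : r <= N by rewrite /N; clear -k1 s4; lia.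
have sN : r + k - 2 + s <= N by rewrite /N; clear -r4 k1; lia.
case: k k1 => [//|[|k]] _ in N N0 GN inj mono ws2 ws3 sub iota_path closed cycle rN sN *.
  have -> : #|G| - 2 = r + s - 3 by rewrite GN /N; clear; lia.
  have r1 : r + 1 - 2 = r.-1 by clear; lia.
  rewrite r1 in ws3 sN.
  have C1 := closed 0 r (leq_trans (isT : 1 < 4) r4) rN ws1.
  have C2 := closed r.-1 s (leq_trans (isT : 1 < 4) s4) sN ws3.
  have rE : r.-1.+1 = r by clear -r4; lia.
  rewrite rE in C2.
  have E2 : iota 1 (r - 2) = rcons (iota 1 (r - 3)) (r - 2).
    have -> : r - 2 = (r - 3) + 1 by clear -r4; lia.
    by rewrite iotaD cats1; congr (rcons _ _); clear; lia.
  have E0 : iota 0 r = 0 :: rcons (iota 1 (r - 3)) (r - 2) ++ [:: r.-1].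
    rewrite -E2 -cat_cons -[0 :: _]/(iota 0 (r - 2).+1).
    have {1}-> : r = (r - 2).+1 + 1 by clear -r4; lia.
    by rewrite iotaD; congr (_ ++ [:: _]); clear -r4; lia.
  have allr : all (gtn N) (iota 0 r) by apply: all_iota.
  have alls : all (gtn N) (iota r s.-1) by apply: all_iota; clear -sN rE s4; lia.
  have lt_r i : i < r -> i < N by move=> ir; apply: leq_trans rN.
  have r0 : 0 < r by clear -r4; lia.
  apply: (@unsafe_touch _ _ (phi r.-1) (phi 0) (map phi (iota 1 (r - 3))) (phi (r - 2))
            (map phi (iota r s.-1))).
  - rewrite -map_rcons -E2; apply: (iota_path 0 (r - 2) [::] [:: r.-1; 0]).
      by rewrite /closed_walk E0 -E2 /= -cats1 -catA in ws1.
    by apply: lt_r; clear -r4; lia.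
  - move: C1; rewrite rcons_path last_map last_iota add0n; by case/andP.
  - rewrite adj_sym; have := C1; rewrite rcons_path => /andP[+ _].
    have -> : iota 1 r.-1 = rcons (iota 1 (r - 3)) (r - 2) ++ [:: r.-1].
      by move: E0; rewrite -{1}rE => -[].
    by rewrite map_cat cat_path map_rcons last_rcons => /andP[_ /andP[]].
  - rewrite -map_rcons -!map_cons (embedding_uniq inj); last first.
      by move: allr; rewrite E0 /= all_cat andbA andbC /= andbT.
    have := iota_uniq 0 r; rewrite E0 -cat_cons cat_uniq => /and3P[un + _].
    by rewrite has_seq1 cons_uniq un andbT.
  - exact: C2.
  - rewrite -map_cons (embedding_uniq inj).
      have -> : r.-1 :: iota r s.-1 = iota r.-1 s.-1.+1 by rewrite /= rE.
      exact: iota_uniq.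
    by rewrite /= alls andbT; apply: lt_r; clear -r4; lia.
  - by rewrite (embedding_mem inj) ?mem_iota ?lt_r // leqNgt r0.
  - by rewrite (embedding_mem inj) ?mem_iota ?lt_r //; clear -r4; lia.
  - by rewrite size_map size_iota; clear -s4; lia.
  - by rewrite size_map size_iota; clear -s4 r4; lia.
  by rewrite size_map size_iota; clear -s4 r4; lia.
have -> : #|G| - 2 = r + k + s - 2 by rewrite GN /N; clear -r4; lia.
have rk : r + k.+2 - 2 = r + k by clear; lia.
rewrite rk in ws3 sN; have rE : (r - 1).+1 = r by clear -r4; lia.
have rltN : r < N by clear -sN s4; lia.
apply: (@unsafe_two_lollipops _ _ (phi (r - 1)) (phi r) [::] (map phi (iota 0 r))
          (map phi (iota r.+1 k)) (map phi (iota (r + k) s))).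
- have := iota_path (r - 1) 1 [::] (iota (r - 1).+2 k) ws2.
  by rewrite addn1 rE => /(_ rltN) /andP[].
- rewrite /lollipop /=; apply/and4P; split.
  + by apply: cycle; rewrite // (leq_trans _ r4).
  + by rewrite (embedding_mem inj) ?all_iota ?mem_iota //; clear -rltN r4; lia.
  + by rewrite (embedding_uniq inj) ?all_iota ?iota_uniq.
  + by rewrite size_map size_iota.
- apply/and5P; split.
  + apply: (iota_path r k [:: r - 1] [::]); last by clear -sN s4; lia.
    by rewrite cats0 -{2}rE.
  + by apply: cycle; rewrite // (leq_trans _ s4).
  + rewrite last_map last_iota (embedding_mem inj) ?all_iota ?mem_iota //; clear -sN s4; lia.
  + rewrite belast_map belast_iota -map_cat -iotaD (embedding_uniq inj) ?all_iota ?iota_uniq //.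
    by clear -sN; lia.
  + by rewrite size_map size_iota.
- by rewrite (embedding_mem inj) ?all_iota ?mem_iota //; clear; lia.
- rewrite -map_cat (embedding_mem inj).
  + by rewrite mem_cat !mem_iota; clear -r4; lia.
  + by clear -rltN; lia.
  by rewrite all_cat !all_iota //; clear -sN s4; lia.
- by rewrite /= size_map size_iota; clear -s4; lia.
by rewrite !size_map !size_iota; clear -s4 r4; lia.
Qed.

End Shapes.

(** * The complete bipartite graph *)
Section K24.
Variable G : sgraph.
Local Notation adj := (@adj G).

Lemma K24_shape : graph_iso G (complete_bipartite 2 4) ->
  #|G| = 6 /\ exists a b (s : seq G), [/\ K2_copy a b s, size s = 4,
    ~~ adj a b, independent [set x in s] & [set: G] = [set x in a :: b :: s]].
Proof.
move=> [h [g hK gK] hmono].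
split; first by rewrite (bij_eq_card (Bijective hK gK)) card_sum !card_ord.
pose H := complete_bipartite 2 4.
pose l (i : 'I_2) : H := inl i; pose r (j : 'I_4) : H := inr j.
have gi : injective g := can_inj gK.
exists (g (l ord0)), (g (l ord_max)), [seq g (r j) | j <- enum 'I_4].
have adjg (x y : H) : adj (g x) (g y) = Defs.adj x y by rewrite -hmono !gK.
split.
- split; last by move=> _ /mapP[j _ ->]; rewrite !adjg.
  have -> : [:: g (l ord0), g (l ord_max) & [seq g (r j) | j <- enum 'I_4]] =
    map g [:: l ord0, l ord_max & [seq r j | j <- enum 'I_4]].
    by rewrite /= -map_comp.
  rewrite map_inj_uniq //= map_inj_uniq ?enum_uniq => [|i j [//]].
  rewrite !inE andbT; apply/andP; split; last by apply/mapP => -[].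
  by apply/norP; split=> //; apply/mapP => -[].
- by rewrite size_map size_enum_ord.
- by rewrite adjg.
- apply/independentP => x y; rewrite !inE => /mapP[i _ ->] /mapP[j _ ->].
  by rewrite adjg.
apply/setP => x; rewrite !inE -[x]hK !(inj_eq gi).
case: (h x) => [i|j].
  by case: i => [[|[|]]] //= i2; rewrite ?(inj_eq (@inl_inj _ _)) -?val_eqE ?orbT.
by rewrite (map_f (fun j => g (r j))) ?mem_enum ?orbT.
Qed.

Lemma K24_safe : graph_iso G (complete_bipartite 2 4) -> safe 4 set0 [set: G].
Proof.
move=> /K24_shape[_ [a [b [s [[un _] s4 ab is_ ->]]]]].
have [abs bs us] : [/\ a \notin b :: s, b \notin s & uniq s] by case/and3P: un.
move: abs; rewrite inE negb_or => /andP[aNb as_].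
have -> : [set x in a :: b :: s] = a |: (b |: [set x in s]).
  by apply/setP => x; rewrite !inE.
by apply: safe_K2m; rewrite ?inE // cardsE (card_uniqP us) s4.
Qed.

(** Lister first marks [a], [t1] and [t2]; then [t1]-[b]-[t2] is a path and
[a]-[t3]-[b]-[t4] a cycle. *)
Lemma K24_unsafe : graph_iso G (complete_bipartite 2 4) -> ~~ safe 5 set0 [set: G].
Proof.
move=> /K24_shape[_ [a [b [s [[un ad] s4 _ _ _]]]]].
case: s s4 un ad => [|t1 [|t2 [|t3 [|t4 []]]]] // _ un ad.
have adE t : t \in [:: t1; t2; t3; t4] -> adj a t /\ adj t b.
  by move=> /ad/andP[]; rewrite (adj_sym t b).
have [|a1 b1] := adE t1; first by rewrite !inE eqxx.
have [|a2 b2] := adE t2; first by rewrite !inE eqxx ?orbT.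
have [|a3 b3] := adE t3; first by rewrite !inE eqxx ?orbT.
have [|a4 b4] := adE t4; first by rewrite !inE eqxx ?orbT.
apply: (@unsafe_touch _ _ a t1 [:: b] t2 [:: t3; b; t4]) => //.
- by rewrite /= b1 adj_sym b2.
- by apply: (uniq_count_le un) => z /=; clear; lia.
- by rewrite /= a3 b3 (adj_sym b) b4 (adj_sym t4) a4.
- by apply: (uniq_count_le un) => z /=; clear; lia.
- suff /andP[] : uniq [:: t1; t3; b; t4] by [].
  by apply: (uniq_count_le un) => z /=; clear; lia.
suff /andP[] : uniq [:: t2; t3; b; t4] by [].
by apply: (uniq_count_le un) => z /=; clear; lia.
Qed.

End K24.

(** * The value of [M] *)
Section Hamilton.
Variables (G : sgraph) (n : nat).
Hypothesis Gn : #|G| = n.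
Local Notation adj := (@adj G).

(** Lister marks all vertices and then two adjacent ones that are left uncolored.
The first move takes [n - 1] of the budget [n] in a single round, which leaves
[n - 1] rounds for [n] marks, as many as [unsafe_lister] needs to continue with
budget 1. *)
Lemma hamilton_odd_cycle (c : seq G) : ucycle adj c -> odd (size c) ->
  size c = n -> 2 < n -> ~ kt_paintable G 2 n.
Proof.
move=> uc oc szc n3 [sigma H].
have leg1 Vs : size Vs = n.-1 -> legal_play (fun _ : G => 1) Vs ->
    wins_on (fun h => sigma ([set: G] :: h)) ([set: G] :\: sigma [:: [set: G]]) Vs
    /\ independent (sigma [:: [set: G]]).
  move=> sz [Vs0 cnt]; have [||H1 H2] := H ([set: G] :: Vs).
  - by rewrite /= sz prednK // ltnW // ltnW.
  - split=> [V|v] /=; last by rewrite inE cnt.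
    rewrite inE => /predU1P[->|/Vs0//]; rewrite -card_gt0 cardsT Gn.
    by clear -n3; lia.
  have /wins_on_cons[_ iX W] : wins_on sigma [set: G] ([set: G] :: Vs) by split=> // v _.
  by split.
have sum1 : \sum_(v : G) 1 = n by rewrite sum1_card.
have [Vs szVs legVs] : exists2 Vs, size Vs = n.-1 & legal_play (fun _ : G => 1) Vs.
  by apply: legal_completion => [v|]; rewrite ?sum1; clear -n3; lia.
have [_ iX] := leg1 Vs szVs legVs.
have [x xc /andP[xX nX]] := odd_cycle_gap uc oc iX.
have xn : adj x (next c x) by apply: next_cycle; case/andP: uc.
set X := sigma _ in iX xX nX leg1.
have uns : ~~ safe 1 (~: X) set0.
  by apply: (@unsafe_adj _ _ _ _ x (next c x)); rewrite ?inE.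
have [||||||Ws [szWs legWs]] := unsafe_lister uns (fun h => sigma ([set: G] :: h))
  (U := [set: G] :\: X) (f := fun _ => 1) (R := n.-1).
- by rewrite -setI_eq0 setI0.
- by rewrite setU0 setTD.
- by [].
- by move=> v; rewrite inE.
- by move=> v; clear -n3; lia.
- by rewrite sum1; clear -n3; lia.
by apply; have [] := leg1 Ws szWs legWs.
Qed.

Lemma odd_cycle_or_unsafe : ~ k_paintable G 2 ->
  (is_odd_cycle G /\ ~ kt_paintable G 2 n) \/ ~~ safe n.-1 set0 [set: G].
Proof.
move=> nP; have [saf|] := boolP (safe n.-1 set0 [set: G]); [left|by right].
have oddP : reflect (exists2 c, ucycle adj c & odd (size c))
    [exists k : 'I_n.+1, exists c : k.-tuple G, ucycleb adj c && odd k].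
  apply: (iffP existsP) => [[k /existsP[c /andP[uc ok]]]|[c uc oc]].
    by exists c; rewrite ?size_tuple.
  have szc : size c < n.+1 by rewrite ltnS (uniq_size_card Gn) //; case/andP: uc.
  by exists (Ordinal szc); apply/existsP; exists (in_tuple c); rewrite oc andbT.
have [[c uc oc]|no] := oddP.
  have isodd := safe_is_odd_cycle Gn saf uc oc; split=> //.
  have [n3 _] := odd_cycle_safe Gn isodd.
  apply: (hamilton_odd_cycle uc oc) => //.
  apply/eqP; rewrite eqn_leq (uniq_size_card Gn); last by case/andP: uc.
  rewrite leqNgt; apply: contraTN saf => lt.
  by apply: unsafe_mono (unsafe_odd_cycle uc oc) => //; clear -lt; lia.
case: nP; apply: safe_k_paintable; apply: (bipartite_safe Gn _ _ saf) => c uc.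
by apply/negP => oc; apply: no; exists c.
Qed.

End Hamilton.

Theorem theorem18 (G : sgraph) (n : nat) (Gn : #|G| = n)
    (G_not_2_paintable : ~ k_paintable G 2) :
  exists2 M : nat, is_M G M &
    [/\ forall r k s : nat, 4 <= r -> 4 <= s -> 1 <= k ->
          graph_iso G (cycle_path_cycle r k s) -> n + 2 <= M,
        forall p q r : nat, 3 <= p -> 1 <= q -> 1 <= r -> 4 <= q + r ->
          graph_iso G (theta_graph p q r) -> n + 2 <= M,
        graph_iso G (complete_bipartite 2 4) -> M = n + 1 /\ n + 1 = 7,
        n <= M
      & M = n <-> is_odd_cycle G].
Proof.
have n0 : 0 < n.
  rewrite lt0n; apply: contra_not_neq G_not_2_paintable => n0.
  apply: safe_k_paintable; apply: safe_independent; apply/independentP => x.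
  by have := card0_eq (etrans Gn n0) x; rewrite inE.
have lower M e : is_M G M -> ~~ safe e set0 [set: G] -> e < n -> 2 * n - e <= M.
  move=> [_ maxM] uns lt; apply: maxM; rewrite -Gn.
  by apply: unsafe_not_kt_paintable; rewrite // Gn.
have upper M e : is_M G M -> safe e set0 [set: G] -> M < 2 * n - e.
  move=> [notM _] saf; rewrite ltnNge; apply/negP => le; apply: notM.
  apply: safe_kt_paintable; rewrite Gn.
  by apply: (safe_mono _ (subxx _) (subxx _) saf); clear -le; lia.
have lower2 M : is_M G M -> ~~ safe (#|G| - 2) set0 [set: G] -> n + 2 <= M.
  rewrite Gn => isM uns; have n2 : 0 < n - 2.
    by rewrite lt0n; apply: contraNneq uns => ->; apply: safe_budget0.
  by have := lower M _ isM uns; clear -n2; lia.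
have [[oddG notn]|uns] := odd_cycle_or_unsafe Gn G_not_2_paintable.
  have [n3 saf] := odd_cycle_safe Gn oddG.
  have isM : is_M G n.
    split=> // t nott; rewrite leqNgt; apply/negP => lt; apply: nott.
    apply: safe_kt_paintable; rewrite Gn.
    by apply: (safe_mono _ (subxx _) (subxx _) saf); clear -lt; lia.
  exists n => //; split=> //.
  - by move=> r k s r4 s4 k1 iso; apply: lower2 isM (unsafe_cycle_path_cycle r4 s4 k1 iso).
  - by move=> p q r p3 q1 r1 qr iso; apply: lower2 isM (unsafe_theta_graph p3 q1 r1 qr iso).
  move=> iso; have [G6 _] := K24_shape iso; have n6 : n = 6 by rewrite -Gn.
  by have := lower n 5 isM (K24_unsafe iso); rewrite n6; clear; lia.
have ex : exists e, ~~ safe e set0 [set: G] by exists n.-1.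
case: (ex_minnP ex) => e0 uns0 min0; have e0n := min0 _ uns.
have e0_gt0 : 0 < e0.
  by rewrite lt0n; apply: contraNneq uns0 => ->; apply: safe_budget0.
have isM : is_M G (2 * n - e0).
  split.
    rewrite -Gn; apply: unsafe_not_kt_paintable => //.
    by rewrite Gn; clear -e0n n0; lia.
  move=> t nott; rewrite leqNgt; apply/negP => lt; apply: nott.
  apply: safe_kt_paintable; rewrite Gn; apply: contraT => /min0.
  by clear -lt e0n n0 e0_gt0; lia.
have Mn1 : n < 2 * n - e0 by clear -e0n n0; lia.
exists (2 * n - e0) => //; split.
- by move=> r k s r4 s4 k1 iso; apply: lower2 isM (unsafe_cycle_path_cycle r4 s4 k1 iso).
- by move=> p q r p3 q1 r1 qr iso; apply: lower2 isM (unsafe_theta_graph p3 q1 r1 qr iso).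
- move=> iso; have [G6 _] := K24_shape iso; have n6 : n = 6 by rewrite -Gn.
  have := lower _ 5 isM (K24_unsafe iso); have := upper _ 4 isM (K24_safe iso).
  by rewrite n6; clear; lia.
- exact: ltnW.
split=> [MnE|oddG]; first by rewrite MnE ltnn in Mn1.
have [_ saf] := odd_cycle_safe Gn oddG.
by have := upper _ _ isM saf; clear -Mn1 n0; lia.
Qed.
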